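(* As formal power series in $q$ whose coefficients are Laurent polynomials in $\zeta$, $$\sum_{\substack{n\ge0\\ m\in\mathbb Z}} \mathrm{ou}(m,n)\zeta^m q^n = \sum_{n\ge0} \frac{q^{2n+1}}{\left(\zeta q,\zeta^{-1}q;q^2\right)_{n+1}},$$ and this series is also equal to each of the following two expressions: $$\sum_{n\ge0} (-1)^{n+1}\zeta^{3n+1}q^{3n^2+2n}\left(1+\zeta q^{2n+1}\right) + \frac{1}{\left(\zeta q,\zeta^{-1}q;q^2\right)_\infty}\sum_{n\ge0} (-1)^n\zeta^{2n+1}q^{n^2+n},$$ $$\frac{q}{\left(q^2;q^2\right)_\infty^2}\left(\sum_{n,r\ge0}-\sum_{n,r<0}\right) \frac{(-1)^{n+r}q^{n^2+3n+4rn+r^2+3r}}{1-\zeta q^{2r+1}}.$$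
   Context: An odd unimodal sequence of weight $n$ is a sequence of odd positive integers of the form $a_1\le\cdots\le a_r\le \overline{c}\ge b_1\ge\cdots\ge b_s$ (with $r,s\ge 0$) having a distinguished (marked) entry $c$, called the peak, such that $n=c+\sum_{j=1}^r a_j+\sum_{j=1}^s b_j$. Sequences with the same entries but differently marked peak positions are counted as different. The rank of the sequence is $r-s$. $\mathrm{ou}(m,n)$ denotes the number of odd unimodal sequences of weight $n$ with rank $m$. Notation: $(a;q)_n:=\prod_{j=0}^{n-1}(1-aq^j)$ and $(a_1,\dots,a_\ell;q)_n:=(a_1;q)_n\cdots(a_\ell;q)_n$ for $n\in\mathbb N_0\cup\{\infty\}$. The sums $\sum_{n,r\ge0}$ and $\sum_{n,r<0}$ run over pairs of integers that are both $\ge0$, respectively both $<0$; the notation $\left(\sum_{n,r\ge0}-\sum_{n,r<0}\right)$ means the difference of the two sums of the same summand. Rational functions are expanded in non-negative powers of $q$; in particular, for $r<0$, $\frac{1}{1-\zeta q^{2r+1}}=-\frac{\zeta^{-1}q^{-2r-1}}{1-\zeta^{-1}q^{-2r-1}}$. *)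

(* Defs.v *)
From HB Require Import structures.
From mathcomp Require Import all_boot all_order all_algebra finmap.
From mathcomp Require Import boolp classical_sets functions cardinality fsbigop.
From mathcomp Require Import zify ring lra.

Set Implicit Arguments.
Unset Strict Implicit.
Unset Printing Implicit Defensive.

Import Order.TTheory GRing.Theory Num.Theory.
Local Open Scope ring_scope.

(** The power series sum_k f_k q^k is given by its coefficient sequence f.
    It is wrapped in a record because plain functions [nat -> R] already carry
    the pointwise ring structure. *)

Record fps (R : Type) := Fps { fcoef : nat -> R }.

Lemma fpsP (R : Type) (f g : fps R) : f = g <-> fcoef f =1 fcoef g.
Proof. by split=> [->//|]; case: f g => [f] [g] /funext /= ->. Qed.

HB.instance Definition _ (R : Type) := gen_eqMixin (fps R).
HB.instance Definition _ (R : Type) := gen_choiceMixin (fps R).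

Section FpsRing.
Variable R : comNzRingType.
Implicit Types f g h : fps R.

Definition fps0 : fps R := Fps (fun=> 0).
Definition fpsC (c : R) : fps R := Fps (fun k => if k == 0%N then c else 0).
Definition fpsX : fps R := Fps (fun k => (k == 1%N)%:R).
Definition fps_opp f : fps R := Fps (fun k => - fcoef f k).
Definition fps_add f g : fps R := Fps (fun k => fcoef f k + fcoef g k).
Definition fps_mul f g : fps R :=
  Fps (fun k => \sum_(i < k.+1) fcoef f i * fcoef g (k - i)%N).

Fact fps_addA : associative fps_add.
Proof. by move=> f g h; apply/fpsP => k /=; rewrite addrA. Qed.
Fact fps_addC : commutative fps_add.
Proof. by move=> f g; apply/fpsP => k /=; rewrite addrC. Qed.
Fact fps_add0 : left_id fps0 fps_add.
Proof. by move=> f; apply/fpsP => k /=; rewrite add0r. Qed.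
Fact fps_addN : left_inverse fps0 fps_opp fps_add.
Proof. by move=> f; apply/fpsP => k /=; rewrite addNr. Qed.

HB.instance Definition _ :=
  GRing.isZmodule.Build (fps R) fps_addA fps_addC fps_add0 fps_addN.

(* truncation, used to transport the ring laws from {poly R} *)
Definition fps_trunc n f : {poly R} := \poly_(i < n.+1) fcoef f i.

Lemma coef_fps_trunc n f k : (k <= n)%N -> (fps_trunc n f)`_k = fcoef f k.
Proof. by move=> kn; rewrite coef_poly ltnS kn. Qed.

Lemma fcoef_mul_trunc n f g k : (k <= n)%N ->
  fcoef (fps_mul f g) k = (fps_trunc n f * fps_trunc n g)`_k.
Proof.
move=> kn; rewrite coefM /=; apply: eq_bigr => i _.
by rewrite !coef_fps_trunc //; have := ltn_ord i; lia.
Qed.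

Fact fps_mulC : commutative fps_mul.
Proof.
by move=> f g; apply/fpsP => k; rewrite !(fcoef_mul_trunc _ _ (leqnn k)) mulrC.
Qed.

Fact fps_mulA : associative fps_mul.
Proof.
move=> f g h; apply/fpsP => k.
have E f1 g1 h1 : fcoef (fps_mul (fps_mul f1 g1) h1) k =
    (fps_trunc k f1 * fps_trunc k g1 * fps_trunc k h1)`_k.
  rewrite coefM; apply: eq_bigr => i _.
  have ik : (i <= k)%N by have := ltn_ord i; lia.
  by rewrite (fcoef_mul_trunc _ _ ik) coef_fps_trunc //; lia.
by rewrite fps_mulC !E [in LHS]mulrC mulrA.
Qed.

Fact fps_mul1 : left_id (fpsC 1) fps_mul.
Proof.
move=> f; apply/fpsP => k /=; rewrite big_ord_recl /= mul1r subn0.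
by rewrite big1 ?addr0 // => i _; rewrite mul0r.
Qed.

Fact fps_mulDl : left_distributive fps_mul fps_add.
Proof.
move=> f g h; apply/fpsP => k /=; rewrite -big_split /=.
by apply: eq_bigr => i _; rewrite mulrDl.
Qed.

Fact fps_oner_neq0 : fpsC 1 != 0 :> fps R.
Proof. by apply/eqP => /fpsP /(_ 0%N) /= /eqP; rewrite oner_eq0. Qed.

HB.instance Definition _ := GRing.Zmodule_isComNzRing.Build (fps R)
  fps_mulA fps_mulC fps_mul1 fps_mulDl fps_oner_neq0.

Lemma fcoef0 k : fcoef (0 : fps R) k = 0. Proof. by []. Qed.
Lemma fcoef1 k : fcoef (1 : fps R) k = (k == 0%N)%:R.
Proof. by rewrite /=; case: eqP. Qed.
Lemma fcoefN f k : fcoef (- f) k = - fcoef f k. Proof. by []. Qed.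
Lemma fcoefD f g k : fcoef (f + g) k = fcoef f k + fcoef g k.
Proof. by []. Qed.
Lemma fcoefM f g k :
  fcoef (f * g) k = \sum_(i < k.+1) fcoef f i * fcoef g (k - i)%N.
Proof. by []. Qed.

Lemma fcoefM0 f g : fcoef (f * g) 0 = fcoef f 0 * fcoef g 0.
Proof. by rewrite fcoefM big_ord1. Qed.

End FpsRing.

(** A power series is invertible iff its constant coefficient is; the
    coefficients of the inverse g of f satisfy
    g_0 = f_0^-1 and g_k = - f_0^-1 (sum_(1 <= i <= k) f_i g_(k-i)). *)
Section FpsInverse.
Variable R : comUnitRingType.
Implicit Types f g : fps R.

(* [:: g_k; g_(k-1); ... ; g_0] *)
Fixpoint fps_inv_seq f (k : nat) : seq R :=
  if k is k'.+1 then
    let s := fps_inv_seq f k' in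
    - (fcoef f 0)^-1 * (\sum_(i < k) fcoef f i.+1 * s`_i) :: s
  else [:: (fcoef f 0)^-1].

Definition fps_unit : pred (fps R) := fun f => fcoef f 0 \is a GRing.unit.
Definition fps_inv f : fps R :=
  if fps_unit f then Fps (fun k => head 0 (fps_inv_seq f k)) else f.

Lemma nth_fps_inv_seq f k i : (i <= k)%N ->
  (fps_inv_seq f k)`_i = head 0 (fps_inv_seq f (k - i)).
Proof.
elim: k i => [|k IHk] [|i] //= ik; first by rewrite subSS IHk.
Qed.

Fact fps_mulVr : {in fps_unit, left_inverse 1 fps_inv *%R}.
Proof.
move=> f; rewrite unfold_in => fU; rewrite mulrC; apply/fpsP => k.
rewrite fcoefM fcoef1 /fps_inv /fps_unit fU; case: k => [|k].
  by rewrite big_ord1 /= divrr.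
rewrite big_ord_recl [fcoef _ (_ - _)]/= mulrA mulrN divrr // mulN1r.
apply/eqP; rewrite addrC subr_eq0; apply/eqP; apply: eq_bigr => i _.
by rewrite /= subSS nth_fps_inv_seq // -ltnS.
Qed.

Fact fps_unitPl f g : g * f = 1 -> fps_unit f.
Proof.
move=> /fpsP /(_ 0%N); rewrite fcoefM0 fcoef1 => gf; apply/unitrP.
by exists (fcoef g 0); split=> //; rewrite mulrC.
Qed.

Fact fps_inv_out : {in [predC fps_unit], fps_inv =1 id}.
Proof. by move=> f; rewrite inE /fps_inv => /negPf fU; rewrite ifF. Qed.

HB.instance Definition _ := GRing.ComNzRing_hasMulInverse.Build (fps R)
  fps_mulVr fps_unitPl fps_inv_out.

Lemma fps_unitE f : (f \is a GRing.unit) = (fcoef f 0 \is a GRing.unit).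
Proof. by []. Qed.

End FpsInverse.

(** Sums are taken coefficientwise: each coefficient of the sum must be a sum
    with only finitely many nonzero terms. *)
Section FpsSum.
Variables (R : comNzRingType) (I : choiceType).

Definition fps_summable (A : set I) (F : I -> fps R) : Prop :=
  forall k, finite_set [set i | A i /\ fcoef (F i) k != 0].

(* [\sum_(i \in A)] is 0 on infinite supports; meaningful when
   [fps_summable A F] *)
Definition fps_sum (A : set I) (F : I -> fps R) : fps R :=
  Fps (fun k => \sum_(i \in A) fcoef (F i) k).

End FpsSum.

Section FpsLim.
Variable R : comNzRingType.

Definition fps_is_lim (u : nat -> fps R) (f : fps R) : Prop :=
  forall k, exists N, forall n, (N <= n)%N -> fcoef (u n) k = fcoef f k.

Definition fps_lim (u : nat -> fps R) : fps R := xget 0 [set f | fps_is_lim u f].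

Lemma fps_is_lim_unique u f g : fps_is_lim u f -> fps_is_lim u g -> f = g.
Proof.
move=> uf ug; apply/fpsP => k; have [N HN] := uf k; have [M HM] := ug k.
by rewrite -(HN (maxn N M)) ?leq_maxl // HM // leq_maxr.
Qed.

Lemma fps_lim_eq u f : fps_is_lim u f -> fps_lim u = f.
Proof.
move=> uf; rewrite /fps_lim; case: xgetP => [g _ /= ug|/(_ f)//].
exact: fps_is_lim_unique ug uf.
Qed.

End FpsLim.

(** (a_1, ..., a_l; b)_n and (a_1, ..., a_l; b)_oo with s = [:: a_1; ...; a_l]. *)
Section Pochhammer.
Variable R : comNzRingType.

Definition qpoch (s : seq (fps R)) (b : fps R) (n : nat) : fps R :=
  \prod_(a <- s) \prod_(j < n) (1 - a * b ^+ j).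

Definition qpoch_inf (s : seq (fps R)) (b : fps R) : fps R :=
  \prod_(a <- s) fps_lim (fun n => \prod_(j < n) (1 - a * b ^+ j)).

Lemma fcoef_exp_small (b : fps R) j k :
  fcoef b 0 = 0 -> (k < j)%N -> fcoef (b ^+ j) k = 0.
Proof.
move=> b0; elim: j k => // j IHj k kj; rewrite exprS fcoefM big1 // => i _.
case: (posnP i) => [->|i0]; first by rewrite b0 mul0r.
by rewrite IHj ?mulr0 //; have := ltn_ord i; lia.
Qed.

(* the infinite products converge as soon as b has no constant term *)
Lemma qpoch_inf_cvg (a b : fps R) : fcoef b 0 = 0 ->
  let u n := \prod_(j < n) (1 - a * b ^+ j) in fps_is_lim u (fps_lim u).
Proof.
move=> b0 u.
have uS n k : (k < n)%N -> fcoef (u n.+1) k = fcoef (u n) k.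
  move=> kn; have -> : u n.+1 = u n - u n * a * b ^+ n.
    by rewrite /u big_ord_recr /= mulrBr mulr1 mulrA.
  rewrite fcoefD fcoefN.
  rewrite fcoefM big1 ?oppr0 ?addr0 // => i _.
  by rewrite fcoef_exp_small ?mulr0 //; lia.
have ulim : fps_is_lim u (Fps (fun k => fcoef (u k.+1) k)).
  move=> k; exists k.+1 => n /subnK <-; elim: (n - k.+1)%N => //= m IHm.
  by rewrite addSn uS ?IHm //; lia.
by rewrite (fps_lim_eq ulim).
Qed.

End Pochhammer.

(** [laurent] is the ring Z[X, X^-1], realised as the subring of the field of
    fractions of Z[X] of the elements x such that X^n x is a polynomial for
    some n. *)

Definition is_laurent : {pred {fraction {poly int}}} := fun x =>
  `[< exists (n : nat) (p : {poly int}),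
        tofrac 'X ^+ n * x = tofrac p >].

Fact is_laurent_subring : subring_closed is_laurent.
Proof.
have L x := asboolP (exists (n : nat) (p : {poly int}),
  tofrac 'X ^+ n * x = tofrac p).
split; first by apply/L; exists 0%N, 1; rewrite mulr1 expr0 tofrac1.
- move=> x y /L[n [p xp]] /L[m [r yr]]; apply/L.
  exists (n + m)%N, ('X^m * p - 'X^n * r).
  by rewrite tofracB !tofracM !tofracXn -xp -yr exprD; ring.
- move=> x y /L[n [p xp]] /L[m [r yr]]; apply/L.
  by exists (n + m)%N, (p * r); rewrite tofracM -xp -yr exprD; ring.
Qed.

HB.instance Definition _ :=
  GRing.isSubringClosed.Build _ is_laurent is_laurent_subring.

Record laurent :=
  Laurent { laurent_val :> {fraction {poly int}}; _ : laurent_val \in is_laurent }.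

HB.instance Definition _ := [isSub for laurent_val].
HB.instance Definition _ := [Choice of laurent by <:].
HB.instance Definition _ := [SubChoice_isSubComNzRing of laurent by <:].

Definition laurent_unit : pred laurent := fun x =>
  (val x != 0) && ((val x)^-1 \in is_laurent).
Definition laurent_inv (x : laurent) : laurent := insubd x (val x)^-1.

Fact laurent_mulVr : {in laurent_unit, left_inverse 1 laurent_inv *%R}.
Proof.
move=> x /andP[x0 xV]; apply: val_inj.
by rewrite rmorphM rmorph1 /= val_insubd xV mulVf.
Qed.

Fact laurent_unitPl (x y : laurent) : y * x = 1 -> laurent_unit x.
Proof.
move=> /(congr1 val); rewrite rmorphM rmorph1 /= => yx.
have x0 : val x != 0.
  by apply: contra_eq_neq yx => ->; rewrite mulr0 eq_sym oner_eq0.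
rewrite /laurent_unit x0 /=; suff -> : (val x)^-1 = val y by exact: valP.
by rewrite -[LHS]mul1r -yx mulfK.
Qed.

Fact laurent_inv_out : {in [predC laurent_unit], laurent_inv =1 id}.
Proof.
move=> x; rewrite inE /= unfold_in negb_and negbK => /orP[/eqP x0|xV].
  by apply: val_inj; rewrite val_insubd x0 invr0 if_same.
by apply: val_inj; rewrite val_insubd (negPf xV).
Qed.

HB.instance Definition _ := GRing.ComNzRing_hasMulInverse.Build laurent
  laurent_mulVr laurent_unitPl laurent_inv_out.

Fact laurentX_proof : tofrac 'X \in is_laurent.
Proof. by apply/asboolP; exists 0%N, 'X; rewrite expr0 mul1r. Qed.
Definition laurentX : laurent := Laurent laurentX_proof.

Lemma laurentX_unit : laurentX \is a GRing.unit.
Proof.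
have X0 : tofrac 'X != 0 :> {fraction {poly int}} by rewrite tofrac_eq0 polyX_eq0.
apply/andP; split=> //; apply/asboolP; exists 1%N, 1.
by rewrite expr1 tofrac1 mulfV.
Qed.

(** The two variables of the power series ring Z[zeta, zeta^-1][[q]]; as zeta is
    a unit there, [zeta ^ m] makes sense for every [m : int]. *)
Definition zeta : fps laurent := fpsC laurentX.
Definition q : fps laurent := fpsX laurent.

Lemma zeta_unit : zeta \is a GRing.unit.
Proof. exact: laurentX_unit. Qed.

(** The sequence a_1 <= ... <= a_r <= c >= b_1 >= ... >= b_s with marked peak c
    is the triple (a, c, b). *)
Definition odd_unimodal (t : seq nat * nat * seq nat) : bool :=
  let: (a, c, b) := t in
  [&& sorted leq (rcons a c), sorted geq (c :: b) & all odd (a ++ c :: b)].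

Definition ou_weight (t : seq nat * nat * seq nat) : nat :=
  let: (a, c, b) := t in (c + sumn a + sumn b)%N.

Definition ou_rank (t : seq nat * nat * seq nat) : int :=
  let: (a, c, b) := t in (size a)%:Z - (size b)%:Z.

Definition ou_set (m : int) (n : nat) : set (seq nat * nat * seq nat) :=
  [set t | [/\ odd_unimodal t, ou_weight t = n & ou_rank t = m]].

Definition ou (m : int) (n : nat) : nat := #|` fset_set (ou_set m n)|%fset.

Lemma ou_set_finite m n : finite_set (ou_set m n).
Proof.
pose S (s : n.-bseq 'I_n.+1) : seq nat := map val s.
pose f (t : n.-bseq 'I_n.+1 * 'I_n.+1 * n.-bseq 'I_n.+1) :=
  (S t.1.1, nat_of_ord t.1.2, S t.2).
apply: (@sub_finite_set _ _ (f @` setT)); last first.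
  by apply: finite_image; exact: finite_finset.
have HS (s : seq nat) : all odd s -> (sumn s <= n)%N -> exists b, S b = s.
  move=> so sn.
  have ss : (size s <= sumn s)%N.
    elim: s so {sn} => //= x s IHs /andP[xo /IHs]; case: x xo => //; lia.
  have sle : all (fun x => x < n.+1)%N s.
    elim: s sn {so ss} => //= x s IHs xsn; rewrite IHs ?andbT; lia.
  have sz : (size (map (inord : nat -> 'I_n.+1) s) <= n)%N.
    by rewrite size_map; lia.
  exists (Bseq sz); rewrite /S /= -map_comp -[RHS]map_id.
  by apply/eq_in_map => x /(allP sle) xn /=; rewrite inordK.
move=> [[a c] b] [/and3P[_ _]] /=.
rewrite all_cat /= => /and3P[ao co bo] w _.
have [||a' a'E] := HS a => //; first lia.
have [||b' b'E] := HS b => //; first lia.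
exists (a', inord c, b') => //=; rewrite /f /= a'E b'E inordK //; lia.
Qed.

(** The rational function 1 / (1 - zeta q^(2r+1)), r in Z, expanded in
    non-negative powers of q. *)
Definition inv_one_sub (r : int) : fps laurent :=
  if 0 <= r then (1 - zeta * q ^ (2 * r + 1))^-1
  else - (zeta^-1 * q ^ (- 2 * r - 1)) / (1 - zeta^-1 * q ^ (- 2 * r - 1)).

(* The integer powers of q in the double sums are never negative. *)
Lemma double_sum_exponent_ge0 (n r : int) :
  (0 <= n) && (0 <= r) || (n < 0) && (r < 0) ->
  0 <= n ^+ 2 + 3 * n + 4 * r * n + r ^+ 2 + 3 * r.
Proof. by case/orP => /andP[? ?]; rewrite !expr2; nia. Qed.

(* Main.v *)
Require Import Defs.
From HB Require Import structures.
From mathcomp Require Import all_boot all_order all_algebra finmap.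
From mathcomp Require Import boolp classical_sets functions cardinality fsbigop.
From mathcomp Require Import zify ring.
Import GRing.Theory.
Local Open Scope classical_set_scope.
Local Open Scope ring_scope.

Set Implicit Arguments.
Unset Strict Implicit.
Unset Printing Implicit Defensive.

(* Removing the largest part from one of the two flanks of an odd unimodal
   sequence gives the first formula.
   With s = zeta^2 and y = q / zeta, the second formula is the case p = q^2 of a
   partial theta identity: replacing s by s p in
   G(s) = sum_n p^n / ((s y; p)_(n+1) (y; p)_(n+1)) gives, by telescoping, a
   contiguous relation between G(s) and G(s p); iterating it produces a partial
   theta sum over (s y; p)_oo (y; p)_oo minus a sum to which the Rogers-Fine
   identity applies.
   For the Hecke-type formula, expand 1 / ((x; p)_(n+1) (y; p)_(n+1)), x y = p,
   into partial fractions in r, exchange the sums over n and r, and evaluate the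
   inner sums sum_k p^k / ((p; p)_k (p; p)_(k+a)), again by a recurrence in a.
   Each recurrence has the form X_j = c_j X_(j+1) with c_j in the ideal (q), for
   the difference X_j of the two sides, so that X_j lies in every power of (q)
   and is 0. *)

(** * Summable families of power series over arbitrary index sets *)

Section FpsSumTheory.
Variables (R : comNzRingType) (I : choiceType).
Implicit Types (A : set I) (F G : I -> fps R).

Lemma fcoef_sum (J : Type) (r : seq J) (P : pred J) (F : J -> fps R) k :
  fcoef (\sum_(i <- r | P i) F i) k = \sum_(i <- r | P i) fcoef (F i) k.
Proof. by apply: (big_morph (fun f => fcoef f k)). Qed.

Lemma eq_fps_sum A F G : {in A, F =1 G} -> fps_sum A F = fps_sum A G.
Proof. by move=> FG; apply/fpsP => k; apply: eq_fsbigr => i /FG ->. Qed.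

Lemma eq_fps_summable A F G :
  {in A, F =1 G} -> fps_summable A F -> fps_summable A G.
Proof.
move=> FG sF k; apply: sub_finite_set (sF k) => i [Ai].
by rewrite -FG ?inE.
Qed.

Lemma sub_fps_summable A B F :
  A `<=` B -> fps_summable B F -> fps_summable A F.
Proof. by move=> AB sF k; apply: sub_finite_set (sF k) => i [/AB]. Qed.

(** Only finitely many indices contribute below degree N. Since every larger finite [s] works too,
    several sums can be compared on one common finite set; the algebraic rules below are proved this
    way. *)
Lemma fps_sum_approx A F N : fps_summable A F ->
  exists2 r : {fset I}, [set` r] `<=` A &
    forall s : {fset I}, (r `<=` s)%fset -> [set` s] `<=` A ->
    forall k, (k < N)%N -> fcoef (fps_sum A F) k = fcoef (\sum_(i <- s) F i) k.
Proof.
move=> sF.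
pose S := \bigcup_(k in `I_N) [set i | A i /\ fcoef (F i) k != 0].
have fS : finite_set S by apply: bigcup_finite => // k _; exact: sF.
exists (fset_set S).
  by move=> i /=; rewrite in_fset_set // inE => -[k _ []].
move=> s rs sA k kN; rewrite fcoef_sum /=.
have -> : \sum_(i <- s) fcoef (F i) k = \sum_(i <- s | i \in A) fcoef (F i) k.
  rewrite big_seq [RHS]big_seq_cond; apply: eq_bigl => i.
  by case: (boolP (i \in s)) => //= /sA Ai; rewrite mem_set.
apply: fsbigE => // i Ai /negP nis; apply: contrapT => /eqP Fi0.
apply: nis; apply: (fsubsetP rs); rewrite in_fset_set // inE.
by exists k.
Qed.

(** The coefficient of degree k in a product only sees the coefficients of F i of degree at most k,
    so the support lies in a finite union of finite supports. *)
Lemma fps_summableM A (f : fps R) F :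
  fps_summable A F -> fps_summable A (fun i => f * F i).
Proof.
move=> sF k; pose S := \bigcup_(j in `I_k.+1) [set i | A i /\ fcoef (F i) j != 0].
have fS : finite_set S by apply: bigcup_finite => // j _; exact: sF.
apply: sub_finite_set fS => i [Ai]; rewrite fcoefM => fF0.
apply: contrapT => nS; move/eqP: fF0; apply; apply: big1 => j _.
have [->|Fj0] := eqVneq (fcoef (F i) (k - j)) 0; first by rewrite mulr0.
by case: nS; exists (k - j)%N => //=; lia.
Qed.

Lemma fps_summableD A F G :
  fps_summable A F -> fps_summable A G -> fps_summable A (fun i => F i + G i).
Proof.
move=> sF sG k; have fU : finite_set ([set i | A i /\ fcoef (F i) k != 0] `|`
    [set i | A i /\ fcoef (G i) k != 0]) by rewrite finite_setU.
apply: sub_finite_set fU => i [Ai] FG0.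
have [F0|F0] := eqVneq (fcoef (F i) k) 0; last by left.
by right; split=> //; move: FG0; rewrite fcoefD F0 add0r.
Qed.

Lemma fps_sumM A (f : fps R) F : fps_summable A F ->
  fps_sum A (fun i => f * F i) = f * fps_sum A F.
Proof.
move=> sF; apply/fpsP => k.
have [r rA Hr] := fps_sum_approx k.+1 sF.
have [r' r'A Hr'] := fps_sum_approx k.+1 (fps_summableM f sF).
have sA : [set` (r `|` r')%fset] `<=` A.
  by move=> i /=; rewrite in_fsetU => /orP[/rA|/r'A].
rewrite (Hr' (r `|` r')%fset) ?fsubsetUr // -mulr_sumr !fcoefM.
by apply: eq_bigr => i _; rewrite (Hr (r `|` r')%fset) ?fsubsetUl //; lia.
Qed.

Lemma fps_sumD A F G : fps_summable A F -> fps_summable A G ->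
  fps_sum A (fun i => F i + G i) = fps_sum A F + fps_sum A G.
Proof.
move=> sF sG; apply/fpsP => k.
have [r rA Hr] := fps_sum_approx k.+1 sF.
have [r' r'A Hr'] := fps_sum_approx k.+1 sG.
have [r'' r''A Hr''] := fps_sum_approx k.+1 (fps_summableD sF sG).
pose s := (r `|` r' `|` r'')%fset.
have sA : [set` s] `<=` A.
  by move=> i /=; rewrite !in_fsetU => /orP[/orP[/rA|/r'A]|/r''A].
have rs : (r `<=` s)%fset by rewrite /s -fsetUA fsubsetUl.
have r's : (r' `<=` s)%fset by rewrite /s (fsetUC r) -fsetUA fsubsetUl.
have r''s : (r'' `<=` s)%fset by rewrite fsubsetUr.
by rewrite fcoefD (Hr s) // (Hr' s) // (Hr'' s) // big_split.
Qed.

Lemma fps_sumN A F : fps_summable A F ->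
  fps_sum A (fun i => - F i) = - fps_sum A F.
Proof.
move=> sF; rewrite -mulN1r -fps_sumM //.
by apply: eq_fps_sum => i _; rewrite mulN1r.
Qed.

Lemma fps_sum_finite A F : finite_set A ->
  fps_sum A F = \sum_(i <- fset_set A) F i.
Proof.
by move=> fA; apply/fpsP => k; rewrite fcoef_sum -fsbig_finite.
Qed.

Lemma fps_sum_set1 i F : fps_sum [set i] F = F i.
Proof. by apply/fpsP => k /=; rewrite fsbig_set1. Qed.

Lemma fps_sumU A B F : A `&` B `<=` set0 -> fps_summable (A `|` B) F ->
  fps_sum (A `|` B) F = fps_sum A F + fps_sum B F.
Proof.
move=> AB sF.
have sA : fps_summable A F by apply: sub_fps_summable sF; left.
have sB : fps_summable B F by apply: sub_fps_summable sF; right.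
apply/fpsP => k.
have [r rA Hr] := fps_sum_approx k.+1 sA.
have [r' r'B Hr'] := fps_sum_approx k.+1 sB.
have [r'' r''U Hr''] := fps_sum_approx k.+1 sF.
(* The finite set [r''] is cut along A and B and added to the approximating sets, so that [sa] and
   [sb] are disjoint and together contain [r'']. *)
pose sa := (r `|` [fset i in r'' | i \in A])%fset.
pose sb := (r' `|` [fset i in r'' | i \in B])%fset.
have saA : [set` sa] `<=` A.
  by move=> i /=; rewrite !inE => /orP[/rA|/andP[_ /set_mem]].
have sbB : [set` sb] `<=` B.
  by move=> i /=; rewrite !inE => /orP[/r'B|/andP[_ /set_mem]].
rewrite fcoefD (Hr sa) ?fsubsetUl // (Hr' sb) ?fsubsetUl //.
rewrite (Hr'' (sa `|` sb)%fset) //; last 2 first.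
- apply/fsubsetP => i ir; have := ir => /r''U [Ai|Bi]; rewrite !inE ir /=.
    by rewrite (mem_set Ai) orbT.
  by rewrite (mem_set Bi) !orbT.
- by move=> i /=; rewrite in_fsetU => /orP[/saA|/sbB]; [left|right].
rewrite -fcoefD; congr (fcoef _ k).
have disj : [disjoint sa & sb]%fset.
  apply/fdisjointP => i ia; apply/negP => ib.
  by apply: (AB i); split; [apply: saA | apply: sbB].
rewrite (perm_big (sa ++ sb)) ?big_cat //=.
apply: uniq_perm; rewrite ?fset_uniq // ?cat_uniq ?fset_uniq /=.
  by rewrite andbT; apply/hasPn => i ib; apply: contraL ib; apply/fdisjointP.
by move=> i; rewrite mem_cat in_fsetU.
Qed.

End FpsSumTheory.

(** * Change of index and summation along the fibres of a map *)

Lemma reindex_fps_sum (R : comNzRingType) (I J : choiceType) (h : I -> J)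
    (A : set I) (B : set J) (F : J -> fps R) : set_bij A B h ->
  fps_sum B F = fps_sum A (F \o h).
Proof. by move=> hbij; apply/fpsP => k /=; exact: reindex_fsbig. Qed.

Lemma reindex_fps_summable (R : comNzRingType) (I J : choiceType) (h : I -> J)
    (A : set I) (B : set J) (F : J -> fps R) : set_bij A B h ->
  fps_summable A (F \o h) -> fps_summable B F.
Proof.
move=> [hAB _ hsurj] sF k; have := finite_image h (sF k).
apply: sub_finite_set => j [/hsurj [i Ai <-] Fi].
by exists i.
Qed.

(** In each degree the support [r k] is finite, so its image under h is finite and contains every j
    whose fibre contributes; the claim reduces to splitting a finite sum by the value of h. Both the
    exchange of sums and the counting of sequences rest on this. *)
Lemma fps_sum_fiber (R : comNzRingType) (I J : choiceType) (h : I -> J)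
    (A : set I) (B : set J) (F : I -> fps R) :
    (forall i, A i -> B (h i)) -> fps_summable A F ->
  let G j := fps_sum (A `&` h @^-1` [set j]) F in
  fps_summable B G /\ fps_sum A F = fps_sum B G.
Proof.
move=> hAB sF G.
pose r k := fset_set [set i | A i /\ fcoef (F i) k != 0].
have rE k i : (i \in r k) = `[< A i /\ fcoef (F i) k != 0 >].
  by rewrite in_fset_set ?inE; last exact: sF.
have GE j k : fcoef (G j) k = \sum_(i <- r k | h i == j) fcoef (F i) k.
  rewrite /= (fsbigE [seq i <- r k | h i == j]) ?filter_uniq ?fset_uniq //.
  - rewrite big_filter_cond big_seq_cond [RHS]big_seq_cond; apply: eq_bigl => i.
    case: (boolP (i \in r k)) => //=; rewrite rE => /asboolP[Ai _].
    by case: eqP => //= hij; rewrite mem_set.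
  - move=> i /=; rewrite mem_filter rE => /andP[/eqP hij /asboolP[Ai _]].
    by split.
  - move=> i [Ai hij]; rewrite mem_filter hij eqxx /= rE.
    by move=> /asboolPn /not_andP[//|/negP/negPn/eqP].
have Gh j k : fcoef (G j) k != 0 -> j \in [fset h i | i in r k]%fset.
  rewrite GE => G0; apply: contraTT G0 => jr; apply/negPn/eqP.
  rewrite big_seq_cond; apply: big1 => i /andP[ir /eqP hij]; case/negP: jr.
  by apply/imfsetP; exists i.
split=> [k|].
  by apply: (sub_finite_set _ (finite_fset [fset h i | i in r k]%fset)) => j [_ /Gh].
apply/fpsP => k /=; rewrite -/(fcoef _ k).
rewrite [LHS](fsbigE (r k)); last 3 first.
- exact: fset_uniq.
- by move=> i /=; rewrite rE => /asboolP[].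
- by move=> i Ai; rewrite rE => /asboolPn /not_andP[//|/negP/negPn/eqP].
rewrite big_seq_cond (eq_bigl (fun i => i \in r k)); last first.
  move=> i; case: (boolP (i \in r k)) => //=; rewrite rE => /asboolP[Ai _].
  by rewrite mem_set.
rewrite -big_seq (partition_big_imfset _ h) /=.
rewrite [RHS](fsbigE [fset h i | i in r k]%fset).
- rewrite [LHS]big_seq_cond [RHS]big_seq_cond; apply: eq_big => [j|j _].
    case: (boolP (j \in [fset h i | i in r k]%fset)) => //= jr.
    have /imfsetP[i ir ->] := jr; move: ir.
    by rewrite /= rE => /asboolP[Ai _]; rewrite mem_set //; exact: hAB.
  by rewrite -GE.
- exact: fset_uniq.
- by move=> j /= /imfsetP[i ir ->]; move: ir; rewrite /= rE => /asboolP[/hAB].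
- by move=> j _; apply: contraNeq => /Gh.
Qed.

(** * The filtration by the ideals (q^n), limits, and series indexed by naturals *)

Definition vanishes (R : comNzRingType) (n : nat) (f : fps R) : Prop :=
  forall k, (k < n)%N -> fcoef f k = 0.

Section Vanishing.
Variable R : comNzRingType.
Implicit Types (f g : fps R) (F w : nat -> fps R).

Lemma vanishesW m n f : (n <= m)%N -> vanishes m f -> vanishes n f.
Proof. by move=> nm fm k kn; apply: fm; lia. Qed.

Lemma vanishesD n f g : vanishes n f -> vanishes n g -> vanishes n (f + g).
Proof. by move=> fn gn k kn; rewrite fcoefD fn // gn // addr0. Qed.

Lemma vanishesN n f : vanishes n f -> vanishes n (- f).
Proof. by move=> fn k kn; rewrite fcoefN fn // oppr0. Qed.

Lemma vanishesM m n f g :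
  vanishes m f -> vanishes n g -> vanishes (m + n) (f * g).
Proof.
move=> fm gn k kn; rewrite fcoefM; apply: big1 => i _.
have [im|mi] := ltnP i m; first by rewrite fm // mul0r.
by rewrite gn ?mulr0 //; have := ltn_ord i; lia.
Qed.

Lemma vanishesMl n f g : vanishes n g -> vanishes n (f * g).
Proof. exact: (@vanishesM 0). Qed.

Lemma vanishesMr n f g : vanishes n f -> vanishes n (f * g).
Proof. by rewrite mulrC; exact: vanishesMl. Qed.

Lemma vanishes_exp n f : vanishes 1 f -> vanishes n (f ^+ n).
Proof.
by move=> f1; elim: n => // n IHn; rewrite exprS; exact: (@vanishesM 1).
Qed.

Lemma vanishes_fpsX : vanishes 1 (fpsX R). Proof. by case. Qed.

Lemma vanishes_eq0 f : (forall n, vanishes n f) -> f = 0.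
Proof. by move=> f0; apply/fpsP => k; rewrite (f0 k.+1). Qed.

(** Induction on n, for all j at once: if every X_j lies in (q^n), then every c_j X_(j+1) lies in
    (q^(n+1)). *)
Lemma contraction_eq0 (X c : nat -> fps R) :
    (forall j, vanishes 1 (c j)) -> (forall j, X j = c j * X j.+1) ->
  forall j, X j = 0.
Proof.
move=> c1 XE j; apply: vanishes_eq0 => n; elim: n j => // n IHn j.
by rewrite XE; exact: (@vanishesM 1).
Qed.

(** The first k coefficients share a threshold, namely the maximum of theirs. In this uniform form
    limits pass through products and inverses. *)
Lemma fps_is_limP (u : nat -> fps R) f :
  fps_is_lim u f <->
  forall k, exists N, forall n, (N <= n)%N -> vanishes k (u n - f).
Proof.
split=> [uf k|uf k].
  elim: k => [|k [N HN]]; first by exists 0%N.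
  have [M HM] := uf k; exists (maxn N M) => n; rewrite geq_max => /andP[Nn Mn].
  move=> i; rewrite ltnS leq_eqVlt => /orP[/eqP ->|]; last exact: HN.
  by rewrite fcoefD fcoefN HM // subrr.
have [N HN] := uf k.+1; exists N => n /HN /(_ k (ltnSn k)) /eqP.
by rewrite fcoefD fcoefN subr_eq0 => /eqP.
Qed.

Lemma fps_is_lim_cst f : fps_is_lim (fun=> f) f.
Proof. by move=> k; exists 0%N. Qed.

Lemma fps_is_lim_shift m (u : nat -> fps R) f :
  fps_is_lim u f -> fps_is_lim (fun n => u (n + m)%N) f.
Proof.
by move=> uf k; have [N HN] := uf k; exists N => n Nn; apply: HN; lia.
Qed.

Lemma fps_is_limS (u : nat -> fps R) f :
  fps_is_lim u f -> fps_is_lim (fun n => u n.+1) f.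
Proof.
by move=> uf k; have [N HN] := uf k; exists N => n Nn; apply: HN; lia.
Qed.

Lemma fps_is_lim_vanish (u : nat -> fps R) :
  (forall n, vanishes n (u n)) -> fps_is_lim u 0.
Proof. by move=> un k; exists k.+1 => n kn; rewrite un. Qed.

Lemma fps_is_limD (u v : nat -> fps R) f g :
  fps_is_lim u f -> fps_is_lim v g -> fps_is_lim (fun n => u n + v n) (f + g).
Proof.
move=> uf vg k; have [N HN] := uf k; have [M HM] := vg k.
exists (maxn N M) => n; rewrite geq_max => /andP[/HN un /HM vn].
by rewrite !fcoefD un vn.
Qed.

Lemma fps_is_limN (u : nat -> fps R) f :
  fps_is_lim u f -> fps_is_lim (fun n => - u n) (- f).
Proof.
by move=> uf k; have [N HN] := uf k; exists N => n /HN un; rewrite !fcoefN un.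
Qed.

Lemma fps_is_limM (u v : nat -> fps R) f g :
  fps_is_lim u f -> fps_is_lim v g -> fps_is_lim (fun n => u n * v n) (f * g).
Proof.
move=> /fps_is_limP uf /fps_is_limP vg; apply/fps_is_limP => k.
have [N HN] := uf k; have [M HM] := vg k.
exists (maxn N M) => n; rewrite geq_max => /andP[/HN un /HM vn].
rewrite (_ : _ - _ = (u n - f) * v n + f * (v n - g)); last by ring.
by apply: vanishesD; [exact: vanishesMr|exact: vanishesMl].
Qed.

Lemma vanishes_summable F :
  (forall n, vanishes n (F n)) -> fps_summable setT F.
Proof.
move=> Fn k; apply: (sub_finite_set _ (finite_II k.+1)) => n [_] /=.
by apply: contraNltn => kn; rewrite Fn.
Qed.

Lemma fcoef_fps_sum_nat F N k : (forall n, vanishes n (F n)) -> (k < N)%N ->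
  fcoef (fps_sum setT F) k = fcoef (\sum_(n < N) F n) k.
Proof.
move=> Fn kN; rewrite fcoef_sum (fsbig_ord _ N (fun n => fcoef (F n) k)) /=.
apply/esym/fsbig_widen => //.
by move=> n [_ /= /negP nN]; rewrite /= Fn //; lia.
Qed.

Lemma fps_sum_nat_lim F : (forall n, vanishes n (F n)) ->
  fps_is_lim (fun N => \sum_(n < N) F n) (fps_sum setT F).
Proof.
by move=> Fn k; exists k.+1 => n kn; rewrite (fcoef_fps_sum_nat Fn kn).
Qed.

Lemma fps_sum_nat_recl F : (forall n, vanishes n (F n)) ->
  fps_sum setT F = F 0%N + fps_sum setT (fun n => F n.+1).
Proof.
move=> Fn; apply: (@fps_is_lim_unique _ (fun N => \sum_(n < N.+1) F n)).
  exact: fps_is_limS (fps_sum_nat_lim Fn).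
move=> k; have [N HN] : exists N, forall n, (N <= n)%N ->
    fcoef (F 0%N + \sum_(i < n) F i.+1) k =
    fcoef (F 0%N + fps_sum setT (fun n => F n.+1)) k.
  apply: fps_is_limD; first exact: fps_is_lim_cst.
  by apply: fps_sum_nat_lim => n; apply: vanishesW (Fn n.+1).
by exists N => n /HN <-; rewrite big_ord_recl.
Qed.

Lemma fps_sum_telescope F w l : (forall n, vanishes n (F n)) ->
  (forall n, F n = w n.+1 - w n) -> fps_is_lim w l ->
  fps_sum setT F = l - w 0%N.
Proof.
move=> Fn Fw wl; apply: (fps_is_lim_unique (fps_sum_nat_lim Fn)).
have := fps_is_limD wl (fps_is_lim_cst (- w 0%N)).
move=> h k; have [N HN] := h k; exists N => n /HN <-; congr (fcoef _ k).
rewrite -(big_mkord xpredT) (eq_big_nat _ _ (fun i _ => Fw i)).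
by rewrite telescope_sumr.
Qed.

Lemma fps_sum_pair (I J : choiceType) (F : I -> J -> fps R) :
  fps_summable setT (fun p : I * J => F p.1 p.2) ->
  let G j := fps_sum setT (F^~ j) in
  fps_summable setT G /\
  fps_sum setT (fun p : I * J => F p.1 p.2) = fps_sum setT G.
Proof.
move=> sF G; have [] := fps_sum_fiber (h := snd) (B := setT) (fun _ _ => Logic.I) sF.
have GE j : fps_sum (setT `&` snd @^-1` [set j]) (fun p : I * J => F p.1 p.2) = G j.
  apply: (@reindex_fps_sum _ _ _ (fun i => (i, j)) setT); split=> //.
  - by move=> i i' _ _ [].
  - by move=> [i j'] [_ /= ->]; exists i.
move=> sG ->; split; first by apply: eq_fps_summable sG => j _; exact: GE.
by apply: eq_fps_sum => j _; exact: GE.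
Qed.

Lemma vanishes_summable2 (F : nat -> nat -> fps R) :
  (forall i j, vanishes (i + j) (F i j)) ->
  fps_summable setT (fun p : nat * nat => F p.1 p.2).
Proof.
move=> Fn k; have := finite_setX (finite_II k.+1) (finite_II k.+1).
apply: sub_finite_set => -[i j] [_] /= Fk.
have : (i + j <= k)%N by apply: contraNleq Fk => kn; rewrite Fn.
by rewrite /mkset; lia.
Qed.

(** Both sides are the sum over all pairs (i, j), taken along the fibres of the second projection
    and of i + j respectively. *)
Lemma fps_sum_triangle (F : nat -> nat -> fps R) :
  (forall i j, vanishes (i + j) (F i j)) ->
  fps_sum setT (fun j => fps_sum setT (F^~ j)) =
  fps_sum setT (fun n => \sum_(j < n.+1) F (n - j)%N j).
Proof.
move=> Fn; have sF := vanishes_summable2 Fn.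
have [_ <-] := fps_sum_pair sF.
have [_ ->] := fps_sum_fiber (h := fun p => (p.1 + p.2)%N) (B := setT)
  (fun _ _ => Logic.I) sF.
apply: eq_fps_sum => n _; pose h (j : nat) := ((n - j)%N, j).
have hbij : set_bij `I_n.+1 (setT `&` (fun p => (p.1 + p.2)%N) @^-1` [set n]) h.
  split=> [j /= jn|i j _ _ [_]|[i j] [_ /= ij]] //.
    by split=> //; rewrite /mkset /=; lia.
  by exists j; rewrite /h /mkset -?ij ?addnK //=; lia.
rewrite (reindex_fps_sum _ hbij); apply/fpsP => k.
by rewrite fcoef_sum (fsbig_ord _ _ (fun j => fcoef (F (n - j)%N j) k)).
Qed.

End Vanishing.

(** * Inverses of power series and of finite and infinite q-Pochhammer symbols *)

Section Inverses.
Variable R : comUnitRingType.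
Implicit Types (a b f : fps R).

Lemma fps_unit1 f : fcoef f 0 = 1 -> f \is a GRing.unit.
Proof. by rewrite fps_unitE => ->; exact: unitr1. Qed.

Lemma fps_unitB a : vanishes 1 a -> 1 - a \is a GRing.unit.
Proof. by move=> a1; apply: fps_unit1; rewrite fcoefD fcoefN a1 ?subr0. Qed.

Lemma fps_is_limV (u : nat -> fps R) f : f \is a GRing.unit ->
  (forall n, u n \is a GRing.unit) ->
  fps_is_lim u f -> fps_is_lim (fun n => (u n)^-1) f^-1.
Proof.
move=> fU uU /fps_is_limP uf; apply/fps_is_limP => k.
have [N HN] := uf k; exists N => n /HN un.
rewrite (_ : _ - _ = - (u n)^-1 * f^-1 * (u n - f)); first exact: vanishesMl.
rewrite -[RHS]mulrA mulNr mulrBr (mulrC f^-1 (u n)) mulVr // mulrBr mulr1.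
by rewrite mulKr // opprB.
Qed.

Lemma qpochS a b n :
  qpoch [:: a] b n.+1 = qpoch [:: a] b n * (1 - a * b ^+ n).
Proof. by rewrite /qpoch !big_seq1 big_ord_recr. Qed.

Lemma qpochSl a b n :
  qpoch [:: a] b n.+1 = (1 - a) * qpoch [:: a * b] b n.
Proof.
rewrite /qpoch !big_seq1 big_ord_recl expr0 mulr1; congr (_ * _).
by apply: eq_bigr => i _; rewrite -mulrA -exprS.
Qed.

Lemma qpoch0 a b : qpoch [:: a] b 0 = 1.
Proof. by rewrite /qpoch big_seq1 big_ord0. Qed.

Lemma qpoch2 a c b n :
  qpoch [:: a; c] b n = qpoch [:: a] b n * qpoch [:: c] b n.
Proof. by rewrite /qpoch big_cons !big_seq1. Qed.

Lemma qpoch_inf2 a c b :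
  qpoch_inf [:: a; c] b = qpoch_inf [:: a] b * qpoch_inf [:: c] b.
Proof. by rewrite /qpoch_inf big_cons !big_seq1. Qed.

Lemma fcoef_qpoch0 a b n : vanishes 1 a -> fcoef (qpoch [:: a] b n) 0 = 1.
Proof.
move=> a1; elim: n => [|n IHn]; first by rewrite qpoch0.
rewrite qpochS fcoefM0 IHn mul1r fcoefD fcoefN (vanishesMr _ a1) //.
by rewrite subr0.
Qed.

Lemma qpoch_unit a b n : vanishes 1 a -> qpoch [:: a] b n \is a GRing.unit.
Proof. by move=> a1; apply: fps_unit1; exact: fcoef_qpoch0. Qed.

Lemma qpoch_is_lim a b : vanishes 1 b ->
  fps_is_lim (qpoch [:: a] b) (qpoch_inf [:: a] b).
Proof.
move=> b1; have := qpoch_inf_cvg a (b1 0%N isT).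
rewrite /qpoch_inf big_seq1 => h k; have [N HN] := h k.
by exists N => n /HN; rewrite /qpoch big_seq1.
Qed.

Lemma qpoch_inf_unit a b : vanishes 1 a -> vanishes 1 b ->
  qpoch_inf [:: a] b \is a GRing.unit.
Proof.
move=> a1 b1; apply: fps_unit1; have [N HN] := qpoch_is_lim a b1 0%N.
by rewrite -(HN N (leqnn N)) fcoef_qpoch0.
Qed.

Lemma qpoch_infSl a b : vanishes 1 b ->
  qpoch_inf [:: a] b = (1 - a) * qpoch_inf [:: a * b] b.
Proof.
move=> b1; apply: (fps_is_lim_unique (fps_is_limS (qpoch_is_lim a b1))).
have := fps_is_limM (fps_is_lim_cst (1 - a)) (qpoch_is_lim (a * b) b1).
by move=> h k; have [N HN] := h k; exists N => n /HN <-; rewrite qpochSl.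
Qed.

Lemma qpoch_inv_is_lim a b : vanishes 1 a -> vanishes 1 b ->
  fps_is_lim (fun n => (qpoch [:: a] b n)^-1) (qpoch_inf [:: a] b)^-1.
Proof.
move=> a1 b1; apply: fps_is_limV; last exact: qpoch_is_lim.
  exact: qpoch_inf_unit.
by move=> n; exact: qpoch_unit.
Qed.

(** Oriented towards the longer product: rewriting with this and the next lemma brings reciprocals
    of neighbouring symbols to a common one, after which [ring] can compare the numerators. *)
Lemma qpoch_invS a b n : vanishes 1 a ->
  (qpoch [:: a] b n)^-1 = (1 - a * b ^+ n) * (qpoch [:: a] b n.+1)^-1.
Proof.
move=> a1; rewrite qpochS invrM ?qpoch_unit //.
  by rewrite mulrA mulrV ?mul1r //; apply: fps_unitB; exact: vanishesMr.
by apply: fps_unitB; exact: vanishesMr.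
Qed.

Lemma qpoch_invSl a b n : vanishes 1 a ->
  (qpoch [:: a * b] b n)^-1 = (1 - a) * (qpoch [:: a] b n.+1)^-1.
Proof.
move=> a1; rewrite qpochSl invrM ?fps_unitB ?qpoch_unit //.
  by rewrite mulrCA mulrV ?mulr1 ?fps_unitB.
exact: vanishesMr.
Qed.

End Inverses.

(** * The partial theta identity and a case of the Rogers-Fine identity *)

Section PartialTheta.
Variables (R : comUnitRingType) (p : fps R).
Hypothesis p1 : vanishes 1 p.
Implicit Types (s x y : fps R).

(** Telescoping of w_n = 1 / ((x; p)_(n+1) (y; p)_n), based on 1 - (1 - x p^(n+1)) (1 - y p^n) = y
    p^n (1 - x p^(n+1)) + x p^(n+1). The two summands on the right produce G(x) and G(x p). *)
Lemma qpoch_lerch_step x y : vanishes 1 x -> vanishes 1 y ->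
  let G x := fps_sum setT (fun n =>
    p ^+ n * ((qpoch [:: x] p n.+1)^-1 * (qpoch [:: y] p n.+1)^-1)) in
  y * G x = (qpoch_inf [:: x] p)^-1 * (qpoch_inf [:: y] p)^-1 - (1 - x)^-1
            - x * p / (1 - x) * G (x * p).
Proof.
move=> x1 y1 G.
have v n x' : vanishes n
    (p ^+ n * ((qpoch [:: x'] p n.+1)^-1 * (qpoch [:: y] p n.+1)^-1)).
  by apply: vanishesMr; exact: vanishes_exp.
have sG x' := vanishes_summable (v ^~ x').
have xU := fps_unitB x1.
apply/eqP; rewrite eq_sym subr_eq eq_sym; apply/eqP.
rewrite -!fps_sumM // -fps_sumD; try exact: fps_summableM.
pose w n := (qpoch [:: x] p n.+1)^-1 * (qpoch [:: y] p n)^-1.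
have w0 : w 0%N = (1 - x)^-1.
  by rewrite /w qpochS !qpoch0 invr1 mulr1 mul1r expr0 mulr1.
rewrite -[X in _ = _ - X]w0.
apply: (fps_sum_telescope (w := w)) => [n|n|].
- by apply: vanishesD; exact: vanishesMl.
- rewrite (qpoch_invSl p n.+1 x1) /w (qpoch_invS _ n.+1 x1) (qpoch_invS _ n y1) exprS.
  rewrite (_ : x * p / (1 - x) * (p ^+ n * ((1 - x) * (qpoch [:: x] p n.+2)^-1 *
      (qpoch [:: y] p n.+1)^-1)) = ((1 - x)^-1 * (1 - x)) *
      (x * p * (p ^+ n * ((qpoch [:: x] p n.+2)^-1 *
      (qpoch [:: y] p n.+1)^-1)))); last by ring.
  by rewrite mulVr //; ring.
- exact: fps_is_limM (fps_is_limS (qpoch_inv_is_lim x1 p1))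
                     (qpoch_inv_is_lim y1 p1).
Qed.

Lemma vanishes_theta s n : vanishes n ((-1) ^+ n * s ^+ n * p ^+ 'C(n.+1, 2)).
Proof.
apply: vanishesMl; apply: (@vanishesW _ 'C(n.+1, 2)); last exact: vanishes_exp.
by rewrite binS bin1; lia.
Qed.

Lemma binS2 n : 'C(n.+1, 2) = ('C(n, 2) + n)%N.
Proof. by rewrite binS bin1. Qed.

(** With G, T, W, U as in the proof, T(s) = 1 - s p T(s p), U(s) = U(s p) / (1 - s y), W(s) = (1 - s
    p W(s p)) / (1 - s y), and [qpoch_lerch_step] relates G(s) to G(s p). Hence X(s) = y G(s) -
    (U(s) T(s) - W(s)) satisfies X(s) = - s p / (1 - s y) X(s p), and [contraction_eq0] applies. *)
Lemma partial_theta s y : vanishes 1 y -> vanishes 1 (s * y) ->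
  y * fps_sum setT (fun n => p ^+ n *
        ((qpoch [:: s * y] p n.+1)^-1 * (qpoch [:: y] p n.+1)^-1)) =
  (qpoch_inf [:: s * y] p)^-1 * (qpoch_inf [:: y] p)^-1
    * fps_sum setT (fun n => (-1) ^+ n * s ^+ n * p ^+ 'C(n.+1, 2))
  - fps_sum setT (fun n => (-1) ^+ n * s ^+ n * p ^+ 'C(n.+1, 2)
                           * (qpoch [:: s * y] p n.+1)^-1).
Proof.
move=> y1 sy1.
pose G s := fps_sum setT (fun n => p ^+ n *
        ((qpoch [:: s * y] p n.+1)^-1 * (qpoch [:: y] p n.+1)^-1)).
pose T s := fps_sum setT (fun n => (-1) ^+ n * s ^+ n * p ^+ 'C(n.+1, 2)).
pose W s := fps_sum setT (fun n => (-1) ^+ n * s ^+ n * p ^+ 'C(n.+1, 2)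
                           * (qpoch [:: s * y] p n.+1)^-1).
pose U s := (qpoch_inf [:: s * y] p)^-1 * (qpoch_inf [:: y] p)^-1.
have TE t : T t = 1 - t * p * T (t * p).
  rewrite {1}/T fps_sum_nat_recl; last exact: vanishes_theta.
  rewrite !expr0 !mul1r -fps_sumM; last first.
    by apply: vanishes_summable; exact: vanishes_theta.
  rewrite -fps_sumN; last first.
    apply: fps_summableM; apply: vanishes_summable; exact: vanishes_theta.
  congr (1 + _); apply: eq_fps_sum => n _.
  by rewrite !exprS exprMn (binS2 n.+1) exprD exprS; ring.
have tP t n : (t * p ^+ n) * p = t * p ^+ n.+1 by rewrite exprSr mulrA.
have sy n : vanishes 1 (s * p ^+ n * y) by rewrite mulrAC; exact: vanishesMr.
have WE t : vanishes 1 (t * y) ->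
    W t = (1 - t * y)^-1 - t * p / (1 - t * y) * W (t * p).
  move=> ty1; have ty2 : vanishes 1 (t * p * y) by rewrite mulrAC; exact: vanishesMr.
  have v u n : vanishes n ((-1) ^+ n * u ^+ n * p ^+ 'C(n.+1, 2)
      * (qpoch [:: u * y] p n.+1)^-1) by apply: vanishesMr; exact: vanishes_theta.
  rewrite {1}/W fps_sum_nat_recl //.
  rewrite !expr0 !mul1r -fps_sumM; last exact: vanishes_summable.
  rewrite -fps_sumN; last by apply: fps_summableM; exact: vanishes_summable.
  rewrite qpochS qpoch0 !mul1r expr0 mulr1.
  congr (_ + _); apply: eq_fps_sum => n _.
  rewrite (mulrAC t p y) (qpoch_invSl p n.+1 ty1) !exprS exprMn (binS2 n.+1).
  rewrite exprD exprS.
  by rewrite -[LHS]mul1r -[X in X * _ = _](mulVr (fps_unitB ty1)); ring.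
have UE t : vanishes 1 (t * y) -> U t = (1 - t * y)^-1 * U (t * p).
  move=> ty1; have ty2 : vanishes 1 (t * y * p) by exact: vanishesMr.
  rewrite /U (qpoch_infSl (t * y) p1) (mulrAC t p y).
  rewrite invrM ?fps_unitB ?qpoch_inf_unit //; ring.
pose X n := y * G (s * p ^+ n) - (U (s * p ^+ n) * T (s * p ^+ n) - W (s * p ^+ n)).
suff X0 : X 0%N = 0.
  by apply/eqP; rewrite -subr_eq0; apply/eqP; rewrite -[RHS]X0 /X expr0 mulr1.
apply: (@contraction_eq0 _ X (fun n => - (s * p ^+ n.+1 / (1 - s * p ^+ n * y)))).
  move=> n; apply: vanishesN; apply: vanishesMr; apply: vanishesMl.
  by rewrite exprS; exact: vanishesMr.
move=> n; rewrite {1}/X {1}/G (qpoch_lerch_step (sy n) y1) (mulrAC _ y p) tP.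
rewrite -/(U _) -/(G _) TE (WE _ (sy n)) tP mulrDr mulr1 mulrN.
(* Only the factor U in front of the shifted T is rewritten; the two other copies of U cancel. *)
rewrite {3}(UE _ (sy n)) tP /X; ring.
Qed.

(** Both sides satisfy F(x) = 1 + x - x^3 p F(x p), the left one by telescoping and the right one by
    splitting off its first term. *)
Lemma rogers_fine x : vanishes 1 x ->
  fps_sum setT (fun n => (-1) ^+ n * x ^+ (2 * n) * p ^+ 'C(n, 2)
                         * (qpoch [:: x] p n.+1)^-1) =
  fps_sum setT (fun n => (-1) ^+ n * x ^+ (3 * n) * p ^+ (3 * 'C(n, 2) + n)
                         * (1 + x * p ^+ n)).
Proof.
move=> x1.
pose h x n := (-1) ^+ n * x ^+ (2 * n) * p ^+ 'C(n, 2) * (qpoch [:: x] p n.+1)^-1.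
pose t x n := (-1) ^+ n * x ^+ (3 * n) * p ^+ (3 * 'C(n, 2) + n) * (1 + x * p ^+ n).
have vx m n u : vanishes 1 u -> vanishes n (u ^+ (m.+1 * n)).
  by move=> u1; apply: (@vanishesW _ (m.+1 * n)); [lia|exact: vanishes_exp].
have vh u n : vanishes 1 u -> vanishes n (h u n).
  by move=> u1; do 2 apply: vanishesMr; apply: vanishesMl; exact: vx.
have vt u n : vanishes 1 u -> vanishes n (t u n).
  by move=> u1; do 2 apply: vanishesMr; apply: vanishesMl; exact: vx.
have xp n : vanishes 1 (x * p ^+ n) by exact: vanishesMr.
have tP u n : (u * p ^+ n) * p = u * p ^+ n.+1 by rewrite exprSr mulrA.
have hE u : vanishes 1 u -> fps_sum setT (h u) =
    1 + u - u ^+ 3 * p * fps_sum setT (h (u * p)).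
  move=> u1; have up1 : vanishes 1 (u * p) by exact: vanishesMr.
  have sh v : vanishes 1 v -> fps_summable setT (h v).
    by move=> v1; apply: vanishes_summable => n; exact: vh.
  apply/eqP; rewrite eq_sym subr_eq eq_sym; apply/eqP.
  rewrite -fps_sumM; last exact: sh.
  rewrite -fps_sumD; [|exact: sh|by apply: fps_summableM; exact: sh].
  (* The factor 1 - u^2 p^n makes w_(n+1) - w_n equal to the sum of the two summands, and gives w_0
     = - (1 - u^2) / (1 - u) = - (1 + u). *)
  pose w n := - ((-1) ^+ n * u ^+ (2 * n) * p ^+ 'C(n, 2)
      * (1 - u ^+ 2 * p ^+ n) * (qpoch [:: u] p n.+1)^-1).
  have -> : 1 + u = 0 - w 0%N.
    rewrite /w sub0r opprK qpochS qpoch0 !expr0 !mulr1 !mul1r.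
    rewrite (_ : 1 - u ^+ 2 = (1 + u) * (1 - u)); last by ring.
    by rewrite mulrK // fps_unitB.
  apply: (fps_sum_telescope (w := w)) => [n|n|].
  - by apply: vanishesD; [exact: vh|apply: vanishesMl; exact: vh].
  - rewrite /h /w (qpoch_invSl p n.+1 u1) (qpoch_invS _ n.+1 u1) exprMn binS2 exprD.
    rewrite mulnS !exprD !exprS !expr0; ring.
  - apply: fps_is_lim_vanish => n; apply: vanishesN; do 3 apply: vanishesMr.
    by apply: vanishesMl; exact: vx.
have tE u : vanishes 1 u -> fps_sum setT (t u) =
    1 + u - u ^+ 3 * p * fps_sum setT (t (u * p)).
  move=> u1; have up1 : vanishes 1 (u * p) by exact: vanishesMr.
  have st : fps_summable setT (t (u * p)).
    by apply: vanishes_summable => n; exact: vt.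
  rewrite fps_sum_nat_recl; last by move=> n; exact: vt.
  rewrite -fps_sumM // -fps_sumN; last exact: fps_summableM.
  congr (_ + _); first by rewrite /t !expr0 !mul1r mulr1.
  apply: eq_fps_sum => n _; rewrite /t binS2 exprMn mulnS mulnDr !exprD.
  rewrite !exprS !expr0; ring.
pose X n := fps_sum setT (h (x * p ^+ n)) - fps_sum setT (t (x * p ^+ n)).
suff X0 : X 0%N = 0.
  by apply/eqP; rewrite -subr_eq0; apply/eqP; rewrite -[RHS]X0 /X expr0 mulr1.
apply: (@contraction_eq0 _ X (fun n => - ((x * p ^+ n) ^+ 3 * p))).
  by move=> n; apply: vanishesN; exact: vanishesMl.
by move=> n; rewrite {1}/X hE // tE // tP /X; ring.
Qed.

End PartialTheta.

(** * Partial fractions and the Hecke-type double sum *)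

Section PartialFractions.
Variables (R : comUnitRingType) (p : fps R).
Hypothesis p1 : vanishes 1 p.

Let ip n : fps R := (qpoch [:: p] p n)^-1.

Let ipS n : ip n = (1 - p ^+ n.+1) * ip n.+1.
Proof. by rewrite /ip (qpoch_invS _ n p1) -exprS. Qed.

Let ip0 : ip 0 = 1. Proof. by rewrite /ip qpoch0 invr1. Qed.

(* The q-binomial theorem at a zero of (z; p)_(2n+1), with the terms r and
   -1-r paired up. *)
Lemma qbinomial_alternating_sum n :
  \sum_(r < n.+2) (-1) ^+ r * p ^+ 'C(r, 2) * (1 - p ^+ (2 * r + 1))
     * ip (n.+1 - r) * ip (n.+1 + r).+1 = 0.
Proof.
pose e n r := (-1) ^+ r * p ^+ 'C(r, 2) * (1 - p ^+ (2 * r + 1))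
     * ip (n - r) * ip (n + r).+1.
have pU k : 1 - p ^+ k.+1 \is a GRing.unit.
  by apply: fps_unitB; rewrite exprS; exact: vanishesMr.
(* Consecutive sums are proportional. The factor 1 - p^m is 0 at m = 0, which starts the induction;
   the sum for m = 0 itself is 1, hence [n.+1] in the statement. *)
suff E m : (1 - p ^+ (2 * m).+2) * (1 - p ^+ (2 * m).+3) *
      (\sum_(r < m.+2) e m.+1 r) =
    (1 - p ^+ m) * (1 - p ^+ m.+2) * \sum_(r < m.+1) e m r.
  have pU2 k l : (1 - p ^+ k.+1) * (1 - p ^+ l.+1) \is a GRing.unit.
    by rewrite unitrM !pU.
  elim: n => [|n IHn].
    apply: (mulrI (pU2 (2 * 0).+1 (2 * 0).+2)).
    by rewrite [LHS](E 0%N) expr0 subrr !mul0r mulr0.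
  apply: (mulrI (pU2 (2 * n.+1).+1 (2 * n.+1).+2)).
  by rewrite [LHS](E n.+1) [X in _ * X]IHn !mulr0.
(* WZ certificate *)
pose w r := (-1) ^+ r * p ^+ 'C(r, 2) *
  (p ^+ (m.+1 - r) * (1 - p ^+ m.+2) + p ^+ m.+2 * (1 - p ^+ m)
   - p ^+ (m.+1 + 2 * r) * (1 - p ^+ m.+2) - p ^+ (m.+1 + r).+1 * (1 - p ^+ m))
  * ip (m.+1 - r) * ip (m.+1 + r).
have w0 : w 0%N = 0 by rewrite /w subn0 addn0; ring.
have eE r : (r < m.+1)%N ->
    (1 - p ^+ (2 * m).+2) * (1 - p ^+ (2 * m).+3) * e m.+1 r =
    (1 - p ^+ m) * (1 - p ^+ m.+2) * e m r - (w r.+1 - w r).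
  (* Writing m = r + a removes the truncated subtractions, so that [ring] can treat p^r and p^a as
     independent. *)
  move=> rm; have mE : m = (r + (m - r))%N by lia.
  rewrite /e /w; move: (m - r)%N mE => a ->.
  have -> : ((r + a).+1 - r)%N = a.+1 by lia.
  have -> : ((r + a).+1 - r.+1)%N = a by lia.
  have -> : ((r + a).+1 + r.+1)%N = ((r + a) + r).+2 by lia.
  have -> : ((r + a).+1 + r)%N = ((r + a) + r).+1 by lia.
  rewrite (ipS a) (ipS (r + a + r).+1) binS2.
  rewrite !(mulnDr, mulnS, mul2n, addnS, addSn, addn0, =^~ addnn).
  by rewrite !(exprS, exprD) expr0; ring.
(* The term r = m + 1 has no partner in the sum for m; it cancels the upper boundary value of the
   telescoping sum. *)
have em : (1 - p ^+ (2 * m).+2) * (1 - p ^+ (2 * m).+3) * e m.+1 m.+1 = w m.+1.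
  rewrite /e /w subnn ip0 (ipS (m.+1 + m.+1)).
  rewrite !(mulnDr, mulnS, mul2n, addnS, addSn, addn0, =^~ addnn).
  by rewrite !(exprS, exprD) expr0; ring.
rewrite mulr_sumr big_ord_recr /= em.
rewrite (eq_bigr (fun r : 'I_m.+1 => (1 - p ^+ m) * (1 - p ^+ m.+2) * e m r -
  (w r.+1 - w r))); last by move=> r _; exact: eE.
rewrite sumrB -mulr_sumr -(big_mkord xpredT (fun r => w r.+1 - w r)).
by rewrite telescope_sumr // w0 subr0 subrK.
Qed.

(** Induction on n, after multiplying by D_(n+1). Since x y = p, D_(n+1) = p^(n+1-r) D_r + (1 -
    p^(n+1-r)) (1 - p^(n+r+2)). The first part cancels the denominator D_r and sums to 0 by
    [qbinomial_alternating_sum]; the second turns the coefficients for n + 1 into those for n. *)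
Lemma qpoch_partial_fraction x y n : vanishes 1 x -> vanishes 1 y -> x * y = p ->
  (qpoch [:: x] p n.+1)^-1 * (qpoch [:: y] p n.+1)^-1 =
  \sum_(r < n.+1) (-1) ^+ r * p ^+ 'C(r.+1, 2) * ip (n - r) * ip (n + r).+1
     * ((1 - p ^+ (2 * r + 1)) / ((1 - x * p ^+ r) * (1 - y * p ^+ r))).
Proof.
move=> x1 y1 xy.
pose D r := (1 - x * p ^+ r) * (1 - y * p ^+ r).
have DU r : D r \is a GRing.unit.
  by rewrite unitrM !fps_unitB //; exact: vanishesMr.
elim: n => [|n IHn].
  rewrite big_ord1 !qpochS !qpoch0 subnn addn0 ip0 !mul1r !expr0 !mulr1.
  rewrite invrM ?fps_unitB // (_ : p ^+ (2 * 0 + 1) = p ^+ 1) // (mulrA (ip 1)).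
  rewrite (mulrC (ip 1)) -ipS ip0 mul1r mulrC //.
apply: (mulrI (DU n.+1)).
have -> : D n.+1 * ((qpoch [:: x] p n.+2)^-1 * (qpoch [:: y] p n.+2)^-1) =
    (qpoch [:: x] p n.+1)^-1 * (qpoch [:: y] p n.+1)^-1.
  by rewrite (qpoch_invS _ n.+1 x1) (qpoch_invS _ n.+1 y1) /D; ring.
rewrite IHn mulr_sumr.
have DE r : (r <= n.+1)%N -> D n.+1 =
    p ^+ (n.+1 - r) * D r + (1 - p ^+ (n.+1 - r)) * (1 - p ^+ (n.+1 + r).+1).
  move=> rn; have {1 4}-> : n.+1 = (r + (n.+1 - r))%N by lia.
  move: (n.+1 - r)%N => a; rewrite /D.
  rewrite (_ : (r + a + r).+1 = (r + r + a).+1); last by lia.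
  by rewrite exprS !exprD; move: (p ^+ r) (p ^+ a) => u v; rewrite -xy; ring.
pose c m r := (-1) ^+ r * p ^+ 'C(r.+1, 2) * ip (m - r) * ip (m + r).+1.
pose d r := (-1) ^+ r * p ^+ 'C(r, 2) * (1 - p ^+ (2 * r + 1))
     * ip (n.+1 - r) * ip (n.+1 + r).+1.
(* The factor p^(n+1-r) combines with the p^r contained in p^C(r+1,2), so the power p^(n+1) in front
   of [d r] is independent of r. *)
have E r : (r <= n.+1)%N ->
    D n.+1 * (c n.+1 r * ((1 - p ^+ (2 * r + 1)) / D r)) = p ^+ n.+1 * d r +
    (1 - p ^+ (n.+1 - r)) * (1 - p ^+ (n.+1 + r).+1) * c n.+1 r *
      ((1 - p ^+ (2 * r + 1)) / D r).
  move=> rn; rewrite {1}(DE _ rn) mulrDl; congr (_ + _); last by ring.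
  rewrite (_ : _ * _ * (_ * _) = (D r / D r) * (p ^+ (n.+1 - r) *
    (c n.+1 r * (1 - p ^+ (2 * r + 1))))); last by ring.
  rewrite divrr // mul1r /c /d binS2 exprD.
  have -> : p ^+ n.+1 = p ^+ (n.+1 - r) * p ^+ r by rewrite -exprD subnK.
  ring.
rewrite [RHS](eq_bigr _ (fun (r : 'I_n.+2) _ => E r (ltn_ord r))).
rewrite big_split /= -mulr_sumr qbinomial_alternating_sum mulr0 add0r.
(* The term r = n + 1 drops out because of its factor 1 - p^0. *)
rewrite [RHS]big_ord_recr /= subnn expr0 subrr !mul0r addr0.
apply: eq_bigr => r _; congr (_ * _); rewrite -/(c n r) /c.
have rn := ltn_ord r; rewrite subSn // (ipS (n - r)) (ipS (n + r).+1) addSn; ring.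
Qed.

(** Both sides satisfy V_a = 1 / (p; p)_oo^2 - p^(a+1) V_(a+1). *)
Lemma sum_inv_qpoch_shift a :
  fps_sum setT (fun k => p ^+ k * (ip k * ip (k + a))) =
  (qpoch_inf [:: p] p)^-1 ^+ 2
    * fps_sum setT (fun n => (-1) ^+ n * p ^+ ('C(n.+1, 2) + n * a)).
Proof.
pose v b k := p ^+ k * (ip k * ip (k + b)).
pose t b n : fps R := (-1) ^+ n * p ^+ ('C(n.+1, 2) + n * b).
have vv b n : vanishes n (v b n) by apply: vanishesMr; exact: vanishes_exp.
have vt b n : vanishes n (t b n).
  apply: vanishesMl; apply: (@vanishesW _ ('C(n.+1, 2) + n * b)).
    by rewrite binS2; lia.
  exact: vanishes_exp.
have sv b := vanishes_summable (vv b).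
have st b := vanishes_summable (vt b).
pose L := (qpoch_inf [:: p] p)^-1.
have vE b : fps_sum setT (v b) = L ^+ 2 - p ^+ b.+1 * fps_sum setT (v b.+1).
  apply/eqP; rewrite eq_sym subr_eq eq_sym; apply/eqP.
  rewrite -fps_sumM // -fps_sumD //; last exact: fps_summableM.
  (* For k > 0 this is 1 / ((p; p)_(k-1) (p; p)_(k+b)); the form chosen also gives the value 0 at k
     = 0. *)
  pose w k := (1 - p ^+ k) * (ip k * ip (k + b)).
  have w0 : w 0%N = 0 by rewrite /w expr0 subrr mul0r.
  rewrite -[RHS]subr0 -[X in _ = _ - X]w0.
  apply: (fps_sum_telescope (w := w)) => [n|n|].
  - by apply: vanishesD => //; exact: vanishesMl.
  - rewrite /w /v addnS -(addSn n) (ipS n) (ipS (n + b)) addSn.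
    by rewrite !exprS exprD; ring.
  - rewrite expr2 -[L * L]mul1r.
    apply: (fps_is_limM (u := fun k => 1 - p ^+ k) (v := fun k => ip k * ip (k + b))).
      rewrite -[X in fps_is_lim _ X]subr0.
      apply: fps_is_limD; first exact: fps_is_lim_cst.
      by apply: fps_is_limN; apply: fps_is_lim_vanish => n; exact: vanishes_exp.
    apply: fps_is_limM; first exact: qpoch_inv_is_lim.
    exact: fps_is_lim_shift (qpoch_inv_is_lim p1 p1).
have tE b : fps_sum setT (t b) = 1 - p ^+ b.+1 * fps_sum setT (t b.+1).
  rewrite fps_sum_nat_recl // -fps_sumM // -fps_sumN; last exact: fps_summableM.
  congr (_ + _); first by rewrite /t !expr0 mul1r.
  apply: eq_fps_sum => n _; rewrite /t (binS2 n.+1).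
  rewrite (_ : ('C(n.+1, 2) + n.+1 + n.+1 * b = b.+1 + ('C(n.+1, 2) + n * b.+1))%N).
    by rewrite exprD exprS; ring.
  by lia.
pose X b := fps_sum setT (v b) - L ^+ 2 * fps_sum setT (t b).
suff X0 : X a = 0 by apply/eqP; rewrite -subr_eq0; apply/eqP; rewrite -[RHS]X0.
apply: (@contraction_eq0 _ X (fun b => - p ^+ b.+1)) => b.
  by apply: vanishesN; rewrite exprS; exact: vanishesMr.
by rewrite /X vE tE; ring.
Qed.

(** Partial fractions, exchange of the sums over n and r, then [sum_inv_qpoch_shift] with a = 2 r +
    1. The two fractions of the summand are kept apart because they become the ranges r >= 0 and r <
    0 of the final formula. *)
Lemma lerch_hecke x y : vanishes 1 x -> vanishes 1 y -> x * y = p ->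
  fps_sum setT (fun n => p ^+ n *
        ((qpoch [:: x] p n.+1)^-1 * (qpoch [:: y] p n.+1)^-1)) =
  (qpoch_inf [:: p] p)^-1 ^+ 2 * fps_sum setT (fun t : nat * nat =>
     (-1) ^+ (t.1 + t.2) *
     p ^+ (t.2 + 'C(t.2.+1, 2) + 'C(t.1.+1, 2) + t.1 * (2 * t.2 + 1)) *
     ((1 - x * p ^+ t.2)^-1 + y * p ^+ t.2 / (1 - y * p ^+ t.2))).
Proof.
move=> x1 y1 xy.
pose K r := (1 - p ^+ (2 * r + 1)) / ((1 - x * p ^+ r) * (1 - y * p ^+ r)).
(* By x y = p, the numerator 1 - p^(2r+1) is 1 - (x p^r) (y p^r). *)
have KE r : K r = (1 - x * p ^+ r)^-1 + y * p ^+ r / (1 - y * p ^+ r).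
  have xU : 1 - x * p ^+ r \is a GRing.unit by apply: fps_unitB; exact: vanishesMr.
  have yU : 1 - y * p ^+ r \is a GRing.unit by apply: fps_unitB; exact: vanishesMr.
  have xyU : (1 - x * p ^+ r) * (1 - y * p ^+ r) \is a GRing.unit.
    by rewrite unitrM xU yU.
  apply: (mulIr xyU); rewrite /K mulrVK // mulrDl mulKr //.
  rewrite (mulrC (1 - x * _) (1 - y * _)) (mulrA _ (1 - y * _)) mulrVK //.
  rewrite addn1 exprS mul2n -addnn exprD.
  by move: (p ^+ r) => u; rewrite -xy; ring.
(* Here k stands for n - r, so that n + r + 1 becomes k + (2 r + 1). *)
pose B k r := p ^+ (k + r) * ((-1) ^+ r * p ^+ 'C(r.+1, 2))
   * (ip k * ip (k + (2 * r + 1))) * K r.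
have vB k r : vanishes (k + r) (B k r).
  by do 3 apply: vanishesMr; exact: vanishes_exp.
transitivity (fps_sum setT (fun n => \sum_(r < n.+1) B (n - r)%N r)).
  apply: eq_fps_sum => n _; rewrite (qpoch_partial_fraction n x1 y1 xy) mulr_sumr.
  apply: eq_bigr => r _; have rn := ltn_ord r; rewrite /B -/(K r).
  rewrite subnK // (_ : (n - r + (2 * r + 1))%N = (n + r).+1); last by lia.
  ring.
rewrite -fps_sum_triangle //.
pose H n r := (-1) ^+ (n + r) *
     p ^+ (r + 'C(r.+1, 2) + 'C(n.+1, 2) + n * (2 * r + 1)) * K r.
have vH n r : vanishes (n + r) (H n r).
  apply: vanishesMr; apply: vanishesMl.
  apply: (vanishesW _ (vanishes_exp p1)).
  by rewrite !binS2; lia.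
have sH := vanishes_summable2 vH.
have -> : fps_sum setT (fun t : nat * nat =>
     (-1) ^+ (t.1 + t.2) *
     p ^+ (t.2 + 'C(t.2.+1, 2) + 'C(t.1.+1, 2) + t.1 * (2 * t.2 + 1)) *
     ((1 - x * p ^+ t.2)^-1 + y * p ^+ t.2 / (1 - y * p ^+ t.2))) =
  fps_sum setT (fun t : nat * nat => H t.1 t.2).
  by apply: eq_fps_sum => t _; rewrite /H KE.
have [sS ->] := fps_sum_pair sH; rewrite -fps_sumM //.
apply: eq_fps_sum => r _.
pose c := p ^+ r * ((-1) ^+ r * p ^+ 'C(r.+1, 2)) * K r.
transitivity (c * fps_sum setT (fun k => p ^+ k * (ip k * ip (k + (2 * r + 1))))).
  rewrite -fps_sumM; last first.
    by apply: vanishes_summable => k; apply: vanishesMr; exact: vanishes_exp.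
  by apply: eq_fps_sum => k _; rewrite /B /c exprD; ring.
rewrite sum_inv_qpoch_shift mulrCA; congr (_ * _).
rewrite -fps_sumM; last first.
  apply: vanishes_summable => n; apply: vanishesMl.
  apply: (vanishesW _ (vanishes_exp p1)).
  by rewrite binS2; lia.
by apply: eq_fps_sum => n _; rewrite /H /c !exprD; ring.
Qed.

End PartialFractions.

(** * Constants and monomials, and finiteness of sets of odd sequences *)

Lemma fpsCM (R : comNzRingType) (c d : R) : fpsC c * fpsC d = fpsC (c * d).
Proof.
apply/fpsP => k; rewrite fcoefM big_ord_recl subn0 big1 => [|i _].
  by rewrite addr0 /=; case: eqP => // _; rewrite mulr0.
by rewrite /= mul0r.
Qed.

Lemma fpsCX (R : comNzRingType) (c : R) n : fpsC c ^+ n = fpsC (c ^+ n).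
Proof. by elim: n => // n IHn; rewrite !exprS IHn fpsCM. Qed.

Lemma fpsCV (R : comUnitRingType) (c : R) :
  c \is a GRing.unit -> (fpsC c)^-1 = fpsC c^-1.
Proof.
move=> cU; have cU' : fpsC c \is a GRing.unit by [].
by apply: (mulrI cU'); rewrite fpsCM !divrr.
Qed.

Lemma fpsC_exprz (R : comUnitRingType) (c : R) (m : int) :
  c \is a GRing.unit -> fpsC c ^ m = fpsC (c ^ m).
Proof.
move=> cU; case: m => n; first by rewrite -!exprnP fpsCX.
by rewrite !NegzE -!exprnN fpsCX fpsCV // unitrX.
Qed.

Lemma fcoefX_exp (R : comNzRingType) n k :
  fcoef (fpsX R ^+ n) k = (k == n)%:R.
Proof.
elim: n k => [|n IHn] k; first by rewrite expr0 fcoef1.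
rewrite exprS fcoefM; case: k => [|k]; first by rewrite big_ord1 /= mul0r.
rewrite big_ord_recl /= mul0r add0r big_ord_recl /= mul1r big1 => [|i _].
  by rewrite addr0 subSS subn0 IHn eqSS.
by rewrite /= mul0r.
Qed.

Lemma fcoef_monomial (R : comNzRingType) (c : R) n k :
  fcoef (fpsC c * fpsX R ^+ n) k = c * (k == n)%:R.
Proof.
rewrite fcoefM big_ord_recl big1 => [|i _]; last by rewrite /= mul0r.
by rewrite addr0 subn0 fcoefX_exp.
Qed.

(** Odd entries are at least 1, so the sum bounds the length as well as the entries. *)
Lemma finite_odd_seqs n :
  finite_set [set s : seq nat | all odd s /\ (sumn s <= n)%N].
Proof.
apply: (@sub_finite_set _ _
  ((fun s : n.-bseq 'I_n.+1 => map val s) @` setT)); last first.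
  by apply: finite_image; exact: finite_finset.
move=> s [so sn].
have ss : (size s <= sumn s)%N.
  elim: s so {sn} => //= x s IHs /andP[xo /IHs]; case: x xo => //; lia.
have sle : all (fun x => x < n.+1)%N s.
  elim: s sn {so ss} => //= x s IHs xsn; rewrite IHs ?andbT; lia.
have sz : (size (map (inord : nat -> 'I_n.+1) s) <= n)%N.
  by rewrite size_map; lia.
exists (Bseq sz) => //=; rewrite -map_comp -[RHS]map_id.
by apply/eq_in_map => x /(allP sle) xn /=; rewrite inordK.
Qed.

(** * The generating function of odd unimodal sequences as a sum over peaks *)

Section OddUnimodalSeries.

Let W (m : int) (n : nat) : fps laurent := zeta ^ m * q ^+ n.

Let fcoefW m n k : fcoef (W m n) k != 0 -> k = n.
Proof.
rewrite /W /zeta fpsC_exprz ?laurentX_unit // fcoef_monomial.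
by case: (eqVneq k n) => // _; rewrite mulr0 eqxx.
Qed.

(** Partitions into parts 1, 3, ..., 2 i - 1, largest part first: the possible flanks next to a peak
    2 i - 1, the left one read from the peak outwards. *)
Let S (i : nat) : set (seq nat) :=
  [set s | [&& all odd s, all (fun x => x < 2 * i)%N s & sorted geq s]].

Let P (t : seq nat * seq nat) : fps laurent :=
  W ((size t.1)%:Z - (size t.2)%:Z) (sumn t.1 + sumn t.2).

Let summableP i j : fps_summable (S i `*` S j) P.
Proof.
move=> k; apply: sub_finite_set (finite_setX (finite_odd_seqs k) (finite_odd_seqs k)).
move=> [a b] [[/= /and3P[ao _ _] /and3P[bo _ _]] /fcoefW kE].
by split; split=> //=; rewrite kE /=; lia.
Qed.

Let S0 : S 0 = [set [::]].
Proof. by apply/seteqP; split=> [[|x s] /= /and3P[]|_ ->]. Qed.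

(** The cases are whether the largest part is 2 i + 1 or not. Parts may repeat, so removing one such
    part leaves a sequence in [S i.+1]; this is the source of the geometric factors. *)
Let SS i : S i.+1 = S i `|` (cons (2 * i + 1)%N @` S i.+1).
Proof.
apply/seteqP; split=> [s|s].
  case: s => [|x s]; first by left.
  rewrite /S /= => /and3P[/andP[xo so] /andP[xi si] xs].
  have [xE|xNE] := eqVneq x (2 * i + 1)%N.
    by right; exists s; rewrite ?xE //= so si (path_sorted xs).
  (* The value 2 i is excluded by parity. *)
  have xlt : (x < 2 * i)%N.
    by rewrite ltn_neqAle; move: xo xi xNE; lia.
  left; rewrite /= xo so xlt xs !andbT /=.
  have : all (geq x) s by apply: order_path_min xs => a b c /=; lia.
  by apply: sub_all => y /=; lia.
move=> [/and3P[so si ss]|[t /and3P[so si ss] <-]]; rewrite /S /=.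
  by rewrite so ss andbT; apply: sub_all si => y /=; lia.
rewrite so si /= path_sortedE ?ss ?andbT; last by move=> a b c /=; lia.
apply/and3P; split; [lia|lia|].
by apply/allP => y ys; move/allP: si => /(_ y ys); move/allP: so => /(_ y ys) /=; lia.
Qed.

Let S_disj i s : S i s -> (cons (2 * i + 1)%N @` S i.+1) s -> False.
Proof. by move=> /and3P[_ si _] [t _ sE]; move: si; rewrite -sE /=; lia. Qed.

Let L i j := fps_sum (S i `*` S j) P.

Let zetaD m m' n n' : W (m + m') (n + n') = W m n * W m' n'.
Proof. by rewrite /W exprzDr ?zeta_unit // exprD; ring. Qed.

Let P_consl x t : P (x :: t.1, t.2) = zeta * q ^+ x * P t.
Proof.
have -> : zeta * q ^+ x = W 1 x by rewrite /W expr1z.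
rewrite /P -zetaD; congr (W _ _); last by rewrite /= addnA.
by rewrite /= -addn1 PoszD; ring.
Qed.

Let P_consr x t : P (t.1, x :: t.2) = zeta^-1 * q ^+ x * P t.
Proof.
have -> : zeta^-1 * q ^+ x = W (-1) x by rewrite /W exprN1.
rewrite /P -zetaD; congr (W _ _); last by rewrite /= addnCA.
by rewrite /= -addn1 PoszD; ring.
Qed.

Let LSl i j : L i.+1 j = L i j + zeta * q ^+ (2 * i + 1) * L i.+1 j.
Proof.
have UE : S i.+1 `*` S j =
    (S i `*` S j) `|` ((cons (2 * i + 1)%N @` S i.+1) `*` S j).
  rewrite {1}SS; apply/seteqP; split=> [[a b] [/= [] aS bS]|[a b] [] [/= aS bS]];
    by [left|right|split=> //; left|split=> //; right].
rewrite {1}/L UE fps_sumU; last 2 first.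
- by move=> [a b] [[/= ai _] [/= a'i _]]; exact: S_disj ai a'i.
- by rewrite -UE.
congr (_ + _); rewrite /L -fps_sumM //.
pose h (t : seq nat * seq nat) := ((2 * i + 1)%N :: t.1, t.2).
rewrite (@reindex_fps_sum _ _ _ h (S i.+1 `*` S j)).
  by apply: eq_fps_sum => t _; exact: P_consl.
split=> [[a b] [/= aS bS]|[a b] [a' b'] _ _ [-> ->]|[a b] [/= [a' aS <-] bS]] //.
  by split=> //=; exists a.
by exists (a', b).
Qed.

Let LSr i j : L i j.+1 = L i j + zeta^-1 * q ^+ (2 * j + 1) * L i j.+1.
Proof.
have UE : S i `*` S j.+1 =
    (S i `*` S j) `|` (S i `*` (cons (2 * j + 1)%N @` S j.+1)).
  rewrite {1}SS; apply/seteqP; split=> [[a b] [/= aS [] bS]|[a b] [] [/= aS bS]];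
    by [left|right|split=> //; left|split=> //; right].
rewrite {1}/L UE fps_sumU; last 2 first.
- by move=> [a b] [[/= _ bj] [/= _ b'j]]; exact: S_disj bj b'j.
- by rewrite -UE.
congr (_ + _); rewrite /L -fps_sumM //.
pose h (t : seq nat * seq nat) := (t.1, (2 * j + 1)%N :: t.2).
rewrite (@reindex_fps_sum _ _ _ h (S i `*` S j.+1)).
  by apply: eq_fps_sum => t _; exact: P_consr.
split=> [[a b] [/= aS bS]|[a b] [a' b'] _ _ [-> ->]|[a b] [/= aS [b' bS <-]]] //.
  by split=> //=; exists b.
by exists (a, b').
Qed.

Let q1 : vanishes 1 q. Proof. exact: vanishes_fpsX. Qed.

(** By [LSl] and [LSr], raising i or j by one divides by one factor 1 - zeta q^(2i+1) or 1 - zeta^-1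
    q^(2j+1); the pair of empty flanks gives the initial value 1. *)
Let L_qpoch i j :
  L i j = (qpoch [:: zeta * q] (q ^+ 2) i)^-1 * (qpoch [:: zeta^-1 * q] (q ^+ 2) j)^-1.
Proof.
have aux (x : fps laurent) (n : nat) : x * q ^+ (2 * n + 1) = x * q * (q ^+ 2) ^+ n.
  by rewrite exprD exprM expr1; ring.
have v (x : fps laurent) n : vanishes 1 (x * q * (q ^+ 2) ^+ n).
  by apply: vanishesMr; exact: vanishesMl.
have step (A B x : fps laurent) : vanishes 1 x -> A = B + x * A -> (1 - x) * A = B.
  by move=> x1 AE; rewrite mulrBl mul1r {1}AE addrK.
elim: i j => [|i IHi] j; last first.
  apply: (mulrI (fps_unitB (v zeta i))).
  rewrite (step _ (L i j) _ (v zeta i)); last by rewrite -aux; exact: LSl.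
  by rewrite IHi (qpoch_invS _ i) ?mulrA //; exact: vanishesMl.
elim: j => [|j IHj]; last first.
  apply: (mulrI (fps_unitB (v zeta^-1 j))).
  rewrite (step _ (L 0 j) _ (v zeta^-1 j)); last by rewrite -aux; exact: LSr.
  by rewrite IHj (qpoch_invS _ j) 1?mulrCA //; exact: vanishesMl.
rewrite !qpoch0 invr1 mulr1 /L S0.
have -> : [set [::]] `*` [set [::]] = [set ([::], [::])] :> set (seq nat * seq nat).
  by apply/seteqP; split=> [[a b] [/= -> ->]|_ ->].
by rewrite fps_sum_set1 /P /W /= expr0z expr0 mulr1.
Qed.

Let T (t : seq nat * nat * seq nat) : fps laurent := W (ou_rank t) (ou_weight t).

Let summableT : fps_summable [set t | odd_unimodal t] T.
Proof.
move=> k; apply: sub_finite_set (finite_setX (finite_setX (finite_odd_seqs k)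
  (finite_II k.+1)) (finite_odd_seqs k)).
move=> [[a c] b] [/= /and3P[_ _]]; rewrite all_cat /= => /and3P[ao co bo] /fcoefW kE.
rewrite kE; split; [split|] => //=; first by split=> //; lia.
  by rewrite /mkset; lia.
by split=> //; lia.
Qed.

(** The sum of zeta^rank q^weight over all sequences is taken along two maps: the fibres of (weight,
    rank) yield the numbers [ou], the fibres of the peak yield independent pairs of flanks. *)
Lemma ou_series_eq :
  let ou_term (p : nat * int) : fps laurent :=
    (ou p.2 p.1)%:R * zeta ^ p.2 * q ^+ p.1 in
  fps_summable setT ou_term /\
  fps_sum setT ou_term = fps_sum setT (fun n => q ^+ (2 * n + 1) *
    ((qpoch [:: zeta * q] (q ^+ 2) n.+1)^-1
     * (qpoch [:: zeta^-1 * q] (q ^+ 2) n.+1)^-1)).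
Proof.
move=> ou_term.
have [] := fps_sum_fiber (h := fun t => (ou_weight t, ou_rank t)) (B := setT)
  (fun _ _ => Logic.I) summableT.
have E1 p : fps_sum ([set t | odd_unimodal t] `&`
    (fun t => (ou_weight t, ou_rank t)) @^-1` [set p]) T = ou_term p.
  case: p => n m; rewrite /ou_term /=.
  have -> : [set t | odd_unimodal t] `&`
      (fun t => (ou_weight t, ou_rank t)) @^-1` [set (n, m)] = ou_set m n.
    by apply/seteqP; split=> [t [/= tU [<- <-]]|t [tU <- <-]].
  rewrite fps_sum_finite; last exact: ou_set_finite.
  rewrite (eq_big_seq (fun=> W m n)) => [|t]; last first.
    by rewrite in_fset_set ?inE; [case=> _ <- <-|exact: ou_set_finite].
  by rewrite big_const_seq iter_addr_0 count_predT -mulrA mulr_natl.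
move=> sE E; split; first by apply: eq_fps_summable sE => p _; exact: E1.
rewrite -(eq_fps_sum (fun p _ => E1 p)) -E.
(* The peak is odd, hence determined by its half: c = 2 n + 1. *)
have [_ ->] := fps_sum_fiber (h := fun t => t.1.2./2) (B := setT)
  (fun _ _ => Logic.I) summableT.
apply: eq_fps_sum => n _.
rewrite -[X in _ = _ * X]L_qpoch /L -fps_sumM; last exact: summableP.
(* The left flank is reversed, since [S] lists parts in decreasing order. *)
pose h (t : seq nat * seq nat) := (rev t.1, (2 * n + 1)%N, t.2).
rewrite (@reindex_fps_sum _ _ _ h (S n.+1 `*` S n.+1)).
  apply: eq_fps_sum => -[a b] _; rewrite /T /P /=.
  have -> : q ^+ (2 * n + 1) = W 0 (2 * n + 1) by rewrite /W expr0z mul1r.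
  by rewrite -zetaD size_rev sumn_rev add0r addnA.
have geq_trans : transitive geq by move=> a b c /=; lia.
have SP s : S n.+1 s <-> all odd s /\ path geq (2 * n + 1) s.
  rewrite /S /= path_sortedE //; split=> [/and3P[-> si ->]|[-> /andP[si ->]]].
    by rewrite andbT; split=> //; apply: sub_all si => y /=; lia.
  by rewrite andbT /=; apply: sub_all si => y /=; lia.
have US a b : odd_unimodal (rev a, (2 * n + 1)%N, b) <-> S n.+1 a /\ S n.+1 b.
  rewrite !SP /odd_unimodal /= -rev_cons rev_sorted /= all_cat all_rev /=.
  have -> : odd (2 * n + 1) by lia.
  by split=> [/and4P[pa pb oa ob]|[[oa pa] [ob pb]]]; [split|apply/and4P; split].
split.
- move=> [a b] [/= aS bS]; split; first exact/US.
  by rewrite /mkset /=; lia.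
- by move=> [a b] [a' b'] _ _ [/(can_inj revK) -> ->].
- move=> [[a c] b] [/= tU cn]; have /and3P[_ _] := tU.
  rewrite all_cat /= => /and3P[_ co _].
  have cE : c = (2 * n + 1)%N by lia.
  exists (rev a, b); last by rewrite /h /= revK cE.
  by apply/US; rewrite revK -cE.
Qed.

End OddUnimodalSeries.

(** * Specialisation to p = q^2 and assembly of the three formulas *)

Lemma triangular2 n : (2 * 'C(n.+1, 2) = n ^ 2 + n)%N.
Proof. by elim: n => // n IHn; rewrite binS2 mulnDr IHn; lia. Qed.

Lemma q_vanishes : vanishes 1 q. Proof. exact: vanishes_fpsX. Qed.

(** The exponent is -(n + r + 2), of the same parity as n + r. *)
Lemma signr_exprz_Negz (R : unitRingType) n r :
  (-1 : R) ^ (Negz n + Negz r) = (-1) ^+ (n + r).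
Proof.
rewrite !NegzE -opprD -PoszD -exprnN invr_sign addSn addnS !exprS.
by rewrite !mulN1r opprK.
Qed.

Lemma inv_one_sub_Posz (r : nat) :
  inv_one_sub r = (1 - zeta * q * (q ^+ 2) ^+ r)^-1.
Proof.
rewrite /inv_one_sub /= (_ : 2 * r%:Z + 1 = (2 * r + 1)%N); last by lia.
by rewrite -exprnP exprD exprM expr1 (mulrC _ q) mulrA.
Qed.

Lemma inv_one_sub_Negz (r : nat) :
  inv_one_sub (Negz r) = - (zeta^-1 * q * (q ^+ 2) ^+ r
                            / (1 - zeta^-1 * q * (q ^+ 2) ^+ r)).
Proof.
rewrite /inv_one_sub /= (_ : - 2 * Negz r - 1 = (2 * r + 1)%N); last by lia.
by rewrite -exprnP exprD exprM expr1 (mulrC _ q) mulrA mulNr.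
Qed.

Theorem theorem1p1 :
  let ou_term (p : nat * int) : fps laurent :=
    (ou p.2 p.1)%:R * zeta ^ p.2 * q ^+ p.1 in
  let term1 (n : nat) : fps laurent :=
    q ^+ (2 * n + 1) / qpoch [:: zeta * q; zeta^-1 * q] (q ^+ 2) n.+1 in
  let term2 (n : nat) : fps laurent :=
    (-1) ^+ n.+1 * zeta ^+ (3 * n + 1) * q ^+ (3 * n ^ 2 + 2 * n)
      * (1 + zeta * q ^+ (2 * n + 1)) in
  let term3 (n : nat) : fps laurent :=
    (-1) ^+ n * zeta ^+ (2 * n + 1) * q ^+ (n ^ 2 + n) in
  let term4 (p : int * int) : fps laurent :=
    let: (n, r) := p in
    (-1) ^ (n + r) * q ^ (n ^+ 2 + 3 * n + 4 * r * n + r ^+ 2 + 3 * r)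
      * inv_one_sub r in
  let nonneg : set (int * int) := [set p : int * int | 0 <= p.1 /\ 0 <= p.2] in
  let neg : set (int * int) := [set p : int * int | p.1 < 0 /\ p.2 < 0] in
  let ou_series : fps laurent := fps_sum [set: nat * int] ou_term in
  [/\ [/\ fps_summable [set: nat * int] ou_term,
          fps_summable [set: nat] term1,
          fps_summable [set: nat] term2
        & fps_summable [set: nat] term3],
      fps_summable nonneg term4 /\ fps_summable neg term4
    & [/\ ou_series = fps_sum [set: nat] term1,
          ou_series = fps_sum [set: nat] term2
            + (qpoch_inf [:: zeta * q; zeta^-1 * q] (q ^+ 2))^-1
              * fps_sum [set: nat] term3
        & ou_series = q / qpoch_inf [:: q ^+ 2] (q ^+ 2) ^+ 2
            * (fps_sum nonneg term4 - fps_sum neg term4)]].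
Proof.
move=> ou_term term1 term2 term3 term4 nonneg neg ou_series.
have q1 := q_vanishes.
pose x := zeta * q; pose y := zeta^-1 * q; pose p := q ^+ 2.
have x1 : vanishes 1 x by exact: vanishesMl.
have y1 : vanishes 1 y by exact: vanishesMl.
have p1 : vanishes 1 p by exact: vanishesMr.
have xy : x * y = p.
  by rewrite /x /y mulrACA divrr ?zeta_unit // mul1r.
have zy : zeta * y = q by rewrite mulrA divrr ?zeta_unit // mul1r.
pose g n := p ^+ n * ((qpoch [:: x] p n.+1)^-1 * (qpoch [:: y] p n.+1)^-1).
have sg : fps_summable setT g.
  by apply: vanishes_summable => n; apply: vanishesMr; exact: vanishes_exp.
have qg n : q ^+ (2 * n + 1) *
    ((qpoch [:: x] p n.+1)^-1 * (qpoch [:: y] p n.+1)^-1) = q * g n.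
  by rewrite addn1 exprS exprM -mulrA.
have t1E n : term1 n = q * g n.
  by rewrite -qg /term1 qpoch2 invrM ?qpoch_unit // (mulrC (_^-1)).
have t2V n : vanishes n (term2 n).
  apply: vanishesMr; apply: vanishesMl.
  by apply: (@vanishesW _ (3 * n ^ 2 + 2 * n)); [lia|exact: vanishes_exp].
have t3V n : vanishes n (term3 n).
  apply: vanishesMl.
  by apply: (@vanishesW _ (n ^ 2 + n)); [lia|exact: vanishes_exp].
pose e (t : nat * nat) := (t.1 ^ 2 + 3 * t.1 + 4 * t.2 * t.1 + t.2 ^ 2 + 3 * t.2)%N.
pose hp (t : nat * nat) : int * int := (Posz t.1, Posz t.2).
pose hn (t : nat * nat) : int * int := (Negz t.1, Negz t.2).
have hp_bij : set_bij setT nonneg hp.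
  split=> [[n r] _|[n r] [n' r'] _ _ [-> ->]|[[n|n] [r|r]] [] //= _ _] //.
  by exists (n, r).
have hn_bij : set_bij setT neg hn.
  split=> [[n r] _|[n r] [n' r'] _ _ [-> ->]|[[n|n] [r|r]] [] //= _ _] //.
  by exists (n, r).
have t4p t : term4 (hp t) =
    (-1) ^+ (t.1 + t.2) * q ^+ e t * (1 - x * p ^+ t.2)^-1.
  case: t => n r; rewrite /term4 /hp /= inv_one_sub_Posz -PoszD -exprnP.
  by rewrite (_ : _ + 3 * r%:Z = e (n, r)) // /e /=; lia.
(* The exponent is invariant under (n, r) -> (-1 - n, -1 - r), so the same [e] serves both
   quadrants. *)
have t4n t : term4 (hn t) =
    - ((-1) ^+ (t.1 + t.2) * q ^+ e t * (y * p ^+ t.2 / (1 - y * p ^+ t.2))).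
  case: t => n r; rewrite /term4 /hn inv_one_sub_Negz signr_exprz_Negz.
  rewrite (_ : _ + 3 * Negz r = e (n, r)) ?mulrN // /e /=; lia.
have Ve (f : nat -> fps laurent) n r :
    vanishes (n + r) ((-1) ^+ (n + r) * q ^+ e (n, r) * f r).
  apply: vanishesMr; apply: vanishesMl.
  by apply: (@vanishesW _ (e (n, r))); [rewrite /e /=; lia|exact: vanishes_exp].
have sp : fps_summable setT (term4 \o hp).
  apply: eq_fps_summable (vanishes_summable2 (Ve (fun r => (1 - x * p ^+ r)^-1))).
  by move=> t _; rewrite [RHS]t4p; case: t.
have sn : fps_summable setT (fun t => - (term4 \o hn) t).
  apply: eq_fps_summable
    (vanishes_summable2 (Ve (fun r => y * p ^+ r / (1 - y * p ^+ r)))).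
  by move=> t _; rewrite [X in _ = - X]t4n opprK; case: t.
have sn' : fps_summable setT (term4 \o hn).
  apply: eq_fps_summable (fps_summableM (-1) sn) => t _.
  by rewrite mulN1r opprK.
have [sou ouE] := ou_series_eq.
have {}ouE : ou_series = q * fps_sum setT g.
  by rewrite /ou_series ouE -fps_sumM //; apply: eq_fps_sum => n _; exact: qg.
split; [split| |rewrite ouE; split].
- exact: sou.
- apply: eq_fps_summable (fps_summableM q sg) => n _; exact: esym (t1E n).
- exact: vanishes_summable.
- exact: vanishes_summable.
- split; first exact: reindex_fps_summable hp_bij sp.
  exact: reindex_fps_summable hn_bij sn'.
- by rewrite -fps_sumM //; apply: eq_fps_sum => n _; rewrite t1E.
(* The prefactor q = zeta y supplies the factor y on the left of [partial_theta]; the remaining zeta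
   accounts for the extra power of zeta in [term2] and [term3]. *)
- have xE : zeta ^+ 2 * y = x by rewrite expr2 -mulrA zy.
  have := partial_theta p1 y1 (s := zeta ^+ 2); rewrite xE => /(_ x1) ptE.
  rewrite -{1}zy -mulrA ptE mulrBr addrC; congr (_ + _).
    (* Here s p = x^2 for s = zeta^2, so s^n p^C(n+1,2) = x^(2n) p^C(n,2), as in [rogers_fine]. *)
    rewrite (_ : fps_sum setT _ = fps_sum setT (fun n => (-1) ^+ n * x ^+ (2 * n) *
        p ^+ 'C(n, 2) * (qpoch [:: x] p n.+1)^-1)); last first.
      apply: eq_fps_sum => n _; congr (_ * _).
      by rewrite binS2 exprD (exprM x) /x /p !exprMn; ring.
    rewrite rogers_fine // -mulNr -fps_sumM; last first.
      apply: vanishes_summable => n; do 2 apply: vanishesMr; apply: vanishesMl.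
      by apply: (@vanishesW _ (3 * n)); [lia|exact: vanishes_exp].
    apply: eq_fps_sum => n _.
    rewrite /term2 /x /p exprMn -!exprM.
    have -> : (3 * n ^ 2 + 2 * n = 3 * n + 2 * (3 * 'C(n, 2) + n))%N.
      by have := triangular2 n; rewrite binS2; lia.
    by rewrite !addn1 !exprS (exprD q (3 * n)); ring.
  rewrite qpoch_inf2 invrM ?qpoch_inf_unit // mulrCA -fps_sumM; last first.
    by apply: vanishes_summable => n; exact: vanishes_theta.
  rewrite (mulrC (_^-1)); congr (_ * _); apply: eq_fps_sum => n _.
  by rewrite /term3 -triangular2 addn1 (exprS zeta (2 * n)) !exprM; ring.
(* With both quadrants indexed by pairs of naturals, the term at (n, r) minus the one at (-1 - n, -1
   - r) is the summand of [lerch_hecke]. *)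
- rewrite (reindex_fps_sum _ hp_bij) (reindex_fps_sum _ hn_bij).
  rewrite -(fps_sumN sn') -(fps_sumD sp sn).
  rewrite [fps_sum setT g](lerch_hecke p1 x1 y1 xy) -[RHS]mulrA exprVn.
  congr (_ * (_ * _)); apply: eq_fps_sum => -[n r] _.
  rewrite [X in _ = X - _]t4p [X in _ = _ - X]t4n opprK -mulrDr; congr (_ * _ * _).
  rewrite /p -exprM; congr (q ^+ _); rewrite /e /=.
  have := triangular2 n; have := triangular2 r; lia.
Qed.
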